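(* Let $\Omega\subset\mathbb{R}^N$ be a Friedrichs admissible domain with best Friedrichs constant $c_{\mathsf f}$. Define the Neumann bi-Laplacian $B_{\mathtt N}:=\mathring{L}L$, i.e. $B_{\mathtt N}u=\Delta^2u$ with $$D(B_{\mathtt N})=\{u\in \mathsf{H}(\Delta,\Omega):\Delta u\in\mathring{\mathsf H}^2(\Omega)\},$$ and let $\mathcal{B}_{\mathtt N}$ be its restriction to $$D(\mathcal{B}_{\mathtt N})=\{u\in \mathsf{H}(\Delta,\Omega)\cap\mathbb{H}^\perp:\Delta u\in\mathring{\mathsf H}^2(\Omega)\},$$ regarded as an operator in the Hilbert space $\mathsf L^2(\Omega)\cap\mathbb{H}^\perp$. Then: (a) $R(B_{\mathtt N})=R(\mathcal{B}_{\mathtt N})=\mathsf L^2(\Omega)\cap\mathbb{H}^\perp$; in particular the range is closed. (b) $\mathcal{B}_{\mathtt N}:D(\mathcal{B}_{\mathtt N})\subset \mathsf L^2(\Omega)\cap\mathbb{H}^\perp\to \mathsf L^2(\Omega)\cap\mathbb{H}^\perp$ is selfadjoint, positive and bijective, with bounded inverse satisfying $\|\mathcal{B}_{\mathtt N}^{-1}\|\le c_{\mathsf f}^4$ (operator norm with respect to $\mathsf L^2$-norms). Moreover, for all $\varphi\in D(\mathcal{B}_{\mathtt N})$, $$\|\varphi\|_{\mathsf L^2(\Omega)}\le c_{\mathsf f}^2\|\Delta\varphi\|_{\mathsf L^2(\Omega)}\le c_{\mathsf f}^4\|\Delta^2\varphi\|_{\mathsf L^2(\Omega)}.$$ (c)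 For every $f\in \mathsf L^2(\Omega)\cap\mathbb{H}^\perp$ there is a unique $u\in \mathsf{H}(\Delta,\Omega)\cap\mathbb{H}^\perp$ with $\Delta u\in\mathring{\mathsf H}^2(\Omega)$ and $\Delta^2u=f$ in $\Omega$ (the Neumann biharmonic problem: $\Delta u=0$ and $n\cdot\nabla\Delta u=0$ on $\partial\Omega$, $u\perp\mathbb{H}$), namely $u=\mathcal{B}_{\mathtt N}^{-1}f$. This $u$ is also the unique element of $\mathsf{H}(\Delta,\Omega)\cap\mathbb{H}^\perp$ satisfying $$\langle\Delta u,\Delta\varphi\rangle_{\mathsf L^2(\Omega)}=\langle f,\varphi\rangle_{\mathsf L^2(\Omega)}\qquad\text{for all }\varphi\in \mathsf{H}(\Delta,\Omega).$$
   Context: A domain is a (nonempty) connected open set $\Omega\subset\mathbb{R}^N$, $N\in\mathbb{N}$; no regularity of the boundary is assumed. $\mathring{\mathsf H}^k(\Omega)$ is the closure of the compactly supported smooth functions $\mathring{\mathsf C}^\infty(\Omega)$ in $\mathsf H^k(\Omega)$. $\Omega$ is called Friedrichs admissible if there is $c_{\mathsf f}>0$ with $\|\varphi\|_{\mathsf L^2(\Omega)}\le c_{\mathsf f}\|\nabla\varphi\|_{\mathsf L^2(\Omega)}$ for all $\varphi\in\mathring{\mathsf H}^1(\Omega)$; $c_{\mathsf f}$ denotes the best such constant. All differential operators are distributional, $\perp$ is orthogonality in $\mathsf L^2(\Omega)$. $\mathsf H(\Delta,\Omega):=\{\varphi\in\mathsf L^2(\Omega):\Delta\varphi\in\mathsf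 L^2(\Omega)\}$, $\mathbb{H}:=\{\varphi\in\mathsf L^2(\Omega):\Delta\varphi=0\}$. $\mathring{L}:\mathring{\mathsf H}^2(\Omega)\subset\mathsf L^2(\Omega)\to\mathsf L^2(\Omega)$, $\varphi\mapsto-\Delta\varphi$, and $L:\mathsf H(\Delta,\Omega)\subset\mathsf L^2(\Omega)\to\mathsf L^2(\Omega)$, $\varphi\mapsto-\Delta\varphi$ (one has $L=\mathring{L}^*$). Positive means $\langle \mathcal{B}u,u\rangle>0$ for all $0\ne u$ in the domain. *)

(* Defs.v *)
From HB Require Import structures.
From mathcomp Require Import all_boot all_order all_algebra.
From mathcomp Require Import all_classical all_reals all_analysis.
From mathcomp Require Import measurable_realfun.
Set Implicit Arguments.
Unset Strict Implicit.
Unset Printing Implicit Defensive.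
Import Order.TTheory GRing.Theory Num.Theory.
Import numFieldNormedType.Exports.
Local Open Scope classical_set_scope.
Local Open Scope ring_scope.

(* R^N is 'rV[R]_N, with its normed-space topology and Borel sigma-algebra. *)
Section borel_rV.
Variables (R : realType) (N : nat).

HB.instance Definition _ := @isMeasurable.Build
  (sigma_display (@open 'rV[R]_N)) 'rV[R]_N <<s @open 'rV[R]_N >>
  (@sigma_algebra0 _ setT _) (@sigma_algebraC _ _)
  (@sigma_algebra_bigcup _ setT _).

Lemma rV_open_measurable (U : set 'rV[R]_N) : open U -> measurable U.
Proof. exact: sub_sigma_algebra. Qed.

Let qball (p : 'rV[rat]_N * nat) : set 'rV[R]_N :=
  ball (map_mx ratr p.1 : 'rV[R]_N) (p.2.+1%:R^-1 : R).

Let open_bigcup_qball (U : set 'rV[R]_N) : open U ->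
  U = \bigcup_(p in [set p | qball p `<=` U]) qball p.
Proof.
move=> oU; apply/seteqP; split=> [x Ux|x [p pU px]]; last exact: pU.
have : nbhs x U by apply: open_nbhs_nbhs.
move=> /nbhs_ballP[e /= e0 xeU].
have e20 : 0 < e / 2 by rewrite divr_gt0.
have [k _ /(_ k (leqnn k)) /= ke] := near_infty_natSinv_lt (PosNum e20).
have k0 : (0 : R) < k.+1%:R^-1 by rewrite invr_gt0.
have /choice[q xq] : forall i, exists q : rat,
    ratr q \in `](x 0 i - k.+1%:R^-1), x 0 i[.
  by move=> i; apply: rat_in_itvoo; rewrite gtrBl.
pose p : 'rV[rat]_N * nat := (\row_i q i, k).
have px : qball p x.
  split=> //= i j; rewrite !mxE ord1 /ball/=.
  have := xq j; rewrite in_itv/= => /andP[q1 q2].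
  by rewrite ltr0_norm ?subr_lt0// opprB ltrBlDr addrC -ltrBlDr.
exists p => //= y py; apply: xeU.
rewrite [e]splitr; apply: (@ball_triangle _ _ (map_mx ratr p.1 : 'rV[R]_N)).
  by apply: ball_sym; apply: le_ball px; exact: ltW.
by apply: le_ball py; exact: ltW.
Qed.

Lemma measurable_fun_rowP d (T : measurableType d) (f : T -> 'rV[R]_N) :
  (forall i, measurable_fun setT (fun x => f x 0 i)) -> measurable_fun setT f.
Proof.
move=> mf; apply: (@measurability _ _ _ _ _ _ (@open 'rV[R]_N)) => //.
move=> _ [U oU <-].
rewrite setTI (open_bigcup_qball oU) preimage_bigcup bigcup_mkcond.
apply: countable_bigcupT_measurable => [|p]; first exact: countableP.
case: ifP => // _.
rewrite (_ : _ @^-1` _ = \bigcap_(i in [set: 'I_N])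
    (fun x => f x 0 i) @^-1` ball (ratr (p.1 0 i) : R) (p.2.+1%:R^-1 : R)).
  apply: fin_bigcap_measurable => [|i _]; first exact: finite_finset.
  rewrite -[X in measurable X]setTI; apply: mf => //.
  by apply: open_measurable; exact: ball_open.
apply/seteqP; split=> [x [_ xp] i _ /=|x xp]; first by have := xp 0 i; rewrite mxE.
by split=> //= i j; rewrite mxE ord1; exact: xp.
Qed.

Lemma continuous_rV_measurable (f : 'rV[R]_N -> R) :
  continuous f -> measurable_fun setT f.
Proof.
move=> /continuousP cf; apply: (measurability _ (RGenOpens.measurableE R)).
move=> _ [_ [a [b ->] <-]]; rewrite setTI; apply: rV_open_measurable.
exact/cf/interval_open.
Qed.
End borel_rV.

Section lebesgue_rV.
Variable R : realType.

Definition rV_cons N (p : measurableTypeR R * 'rV[R]_N) : 'rV[R]_N.+1 :=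
  row_mx (p.1 : R)%:M p.2.

Lemma rV_consl N p (j : 'I_1) : @rV_cons N p 0 (lshift N j) = p.1.
Proof. by rewrite /rV_cons (@row_mxEl _ 1 1 N) mxE !ord1 mulr1n. Qed.

Lemma rV_consr N p (j : 'I_N) : @rV_cons N p 0 (rshift 1 j) = p.2 0 j.
Proof. by rewrite /rV_cons (@row_mxEr _ 1 1 N). Qed.

Lemma measurable_rV_cons N : measurable_fun setT (@rV_cons N).
Proof.
apply: measurable_fun_rowP => i.
case: (@split_ordP 1 N i) => j ->.
  under eq_fun do rewrite rV_consl; exact: measurable_fst.
under eq_fun do rewrite rV_consr.
apply: (@measurableT_comp _ _ _ _ _ _ (fun x : 'rV[R]_N => x 0 j)) => //.
by apply: continuous_rV_measurable; exact: coord_continuous.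
Qed.

HB.instance Definition _ N :=
  @isMeasurableFun.Build _ _ _ _ (@rV_cons N) (@measurable_rV_cons N).

Section cons_measure.
Variables (N : nat) (mu : {sigma_finite_measure set 'rV[R]_N -> \bar R}).

Definition cons_measure : set 'rV[R]_N.+1 -> \bar R :=
  pushforward ((@lebesgue_measure R) \x mu)%E (@rV_cons N).

Let cons0 : cons_measure set0 = 0%E.
Proof. exact: measure0. Qed.

Let cons_ge0 A : (0 <= cons_measure A)%E.
Proof. exact: measure_ge0. Qed.

Let cons_sigma_additive : semi_sigma_additive cons_measure.
Proof. exact: measure_semi_sigma_additive. Qed.

HB.instance Definition _ := isMeasure.Build _ _ _ cons_measure
  cons0 cons_ge0 cons_sigma_additive.

Let cons_sigma_finite : sigma_finite setT cons_measure.
Proof.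
have /sigma_finiteP[F [UF ndF Foo]] := sigma_finiteT (@lebesgue_measure R).
have /sigma_finiteP[G [UG ndG Goo]] := sigma_finiteT mu.
pose g (x : 'rV[R]_N.+1) : measurableTypeR R * 'rV[R]_N :=
  (x 0 ord0, rsubmx (x : 'rV_(1 + N))).
have gK p : g (rV_cons p) = p.
  case: p => a v; rewrite /g (@row_mxKr _ 1 1 N); congr pair.
  by rewrite (_ : ord0 = lshift N (ord0 : 'I_1)) ?rV_consl//; exact/val_inj.
have mg : measurable_fun setT g.
  apply/measurable_fun_pairP; split.
    by apply: continuous_rV_measurable; exact: coord_continuous.
  apply: measurable_fun_rowP => i /=.
  under eq_fun do rewrite mxE.
  by apply: continuous_rV_measurable; exact: coord_continuous.
exists (fun k => g @^-1` (F k `*` G k)).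
  rewrite -preimage_bigcup (_ : \bigcup_k _ = setT) ?preimage_setT//.
  apply/seteqP; split=> // -[x y] _.
  have [n _ Fnx] : (\bigcup_k F k) x by rewrite -UF.
  have [k _ Gky] : (\bigcup_k G k) y by rewrite -UG.
  exists (maxn n k) => //; split.
  - by move: x Fnx; exact/subsetPset/ndF/leq_maxl.
  - by move: y Gky; exact/subsetPset/ndG/leq_maxr.
move=> k; have [mF ltF] := Foo k; have [mG ltG] := Goo k; split.
  by rewrite -[X in measurable X]setTI; apply: mg => //; exact: measurableX.
rewrite /cons_measure /pushforward (_ : _ @^-1` _ = F k `*` G k).
  by rewrite product_measure1E// lte_mul_pinfty// ge0_fin_numE.
by apply/funext => p; rewrite /preimage /mkset gK.
Qed.

HB.instance Definition _ := Measure_isSigmaFinite.Build _ _ _ cons_measure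
  cons_sigma_finite.
End cons_measure.

Fixpoint lebesgue_rV N : {sigma_finite_measure set 'rV[R]_N -> \bar R} :=
  if N is N'.+1 then cons_measure (lebesgue_rV N') else dirac (0 : 'rV[R]_0).

(* The boxes characterize lebesgue_rV as the N-dimensional Lebesgue measure. *)
Lemma lebesgue_rV_box N (a b : 'rV[R]_N) : (forall i, a 0 i <= b 0 i) ->
  lebesgue_rV N [set x : 'rV[R]_N | forall i, a 0 i < x 0 i <= b 0 i] =
  (\prod_(i < N) (b 0 i - a 0 i))%:E.
Proof.
elim: N a b => [|N IH] a b ab.
  rewrite big_ord0 /= diracE mem_set//= => -[]//.
pose a' : 'rV[R]_N := rsubmx (a : 'rV_(1 + N)).
pose b' : 'rV[R]_N := rsubmx (b : 'rV_(1 + N)).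
have aE i : a' 0 i = a 0 (lift ord0 i).
  by rewrite mxE; congr (a _ _); apply/val_inj.
have bE i : b' 0 i = b 0 (lift ord0 i).
  by rewrite mxE; congr (b _ _); apply/val_inj.
have pre : @rV_cons N @^-1` [set x : 'rV[R]_N.+1 | forall i, a 0 i < x 0 i <= b 0 i] =
    `](a 0 ord0), (b 0 ord0)]%classic `*`
    [set x : 'rV[R]_N | forall i, a' 0 i < x 0 i <= b' 0 i].
  apply/seteqP; split=> -[x y] /=.
    move=> xy; split.
      have := xy (lshift N (ord0 : 'I_1)); rewrite rV_consl in_itv/=.
      by rewrite lshift0.
    move=> i; have := xy (rshift 1 i); rewrite rV_consr aE bE.
    by rewrite rshift1.
  rewrite in_itv/= => -[x0 y0] i; case: (@split_ordP 1 N i) => j ->.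
    by rewrite rV_consl (ord1 j) lshift0.
  have := y0 j; rewrite rV_consr aE bE.
  by rewrite rshift1.
have mbox : measurable [set x : 'rV[R]_N | forall i, a' 0 i < x 0 i <= b' 0 i].
  rewrite (_ : mkset _ = \bigcap_(i in [set: 'I_N])
      (fun x : 'rV[R]_N => x 0 i) @^-1` `](a' 0 i), (b' 0 i)]%classic).
    apply: fin_bigcap_measurable => [|i _]; first exact: finite_finset.
    rewrite -[X in measurable X]setTI.
    by apply: continuous_rV_measurable => //; exact: coord_continuous.
  apply/seteqP; split=> x /= xab i; first by move=> _ /=; rewrite in_itv/=.
  by have /= := xab i I; rewrite in_itv/=.
rewrite /= /cons_measure /pushforward pre product_measure1E//=.
rewrite IH => [|i]; last by rewrite aE bE.
rewrite lebesgue_measure_itv/= lte_fin big_ord_recl.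
under eq_bigr do rewrite aE bE.
have := ab ord0; rewrite le_eqVlt => /predU1P[->|->]; last by rewrite EFinM.
by rewrite ltxx subrr mul0e mul0r.
Qed.
End lebesgue_rV.

Section L2.
Context d (T : measurableType d) (R : realType).
Variable mu : {measure set T -> \bar R}.
Local Open Scope quotient_scope.

(* L^2(mu), as classes of functions modulo equality mu-almost everywhere. *)
Definition L2space := LspaceType2 mu.

Definition L2fun (f : L2space) : T -> R := f.
Coercion L2fun : L2space >-> Funclass.

Lemma measurable_L2fun (f : L2space) : measurable_fun setT (f : T -> R).
Proof.
have h : measurable_fun setT (repr (f : {mfun_ mu, T >-> measurableTypeR R})) by [].
exact: h.
Qed.

Lemma L2P (f : L2space) : (f : T -> R) \in Lfun mu 2%:E.
Proof.
apply/andP; split; rewrite inE/=; first exact: measurable_L2fun.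
exact: (@Lebesgue_finite _ _ _ _ _ _ f).
Qed.

Lemma L2_eqP (f g : L2space) : (f : T -> R) = g %[ae mu] -> f = g.
Proof.
move=> fg.
have : LebesgueSpace.sort f = LebesgueSpace.sort g.
  rewrite -[LHS]reprK -[RHS]reprK; apply/eqmodP; exact/asboolP.
case: f g {fg} => f [[fP]] [g [[gP]]] /= fg.
move: fP gP; rewrite fg => fP gP; congr LebesgueSpace.Pack.
by congr LebesgueSpace.Class; congr isFinLebesgue.phant_Build;
  exact: Prop_irrelevance.
Qed.

Lemma ae_eq_Lnorm2 (f g : T -> R) :
  measurable_fun setT f -> measurable_fun setT g -> f = g %[ae mu] ->
  ('N[mu]_2%:E[EFin \o f] = 'N[mu]_2%:E[EFin \o g])%E.
Proof.
move=> mf mg fg; rewrite unlock; congr poweR.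
have mpow (k : T -> R) : measurable_fun setT k ->
    measurable_fun setT (fun x => (`|(EFin \o k) x| `^ 2)%E).
  move=> mk; rewrite (_ : (fun _ => _) = EFin \o (fun x => `|k x| `^ 2))//.
  apply/measurable_EFinP.
  apply: (measurableT_comp (measurable_powR _)) => //.
  exact: measurableT_comp.
apply: ge0_ae_eq_integral => //; try exact: mpow.
- by move=> x _; exact: poweR_ge0.
- by move=> x _; exact: poweR_ge0.
- by apply: filterS fg => x /= fgx _; rewrite fgx.
Qed.

Section mkL2.
Variables (h : T -> R) (hL : h \in Lfun mu 2%:E).
Let mh : measurable_fun setT (h : T -> measurableTypeR R).
Proof. exact: (set_mem (sub_Lfun_mfun hL)). Qed.
Let hm : {mfun T >-> measurableTypeR R} :=
  HB.pack (h : T -> measurableTypeR R)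
    (@isMeasurableFun.Build _ _ T (measurableTypeR R) h mh).
Let c : {mfun_ mu, T >-> measurableTypeR R} := \pi hm.
Let ch : (c : T -> R) = h %[ae mu].
Proof. by have /eqmodP/asboolP := reprK c. Qed.
Let cfin : finite_norm mu 2%:E c.
Proof.
rewrite /finite_norm (ae_eq_Lnorm2 _ _ ch) //.
- exact: (set_mem (sub_Lfun_finLfun hL)).
- have mc : measurable_fun setT (repr c) by [].
  exact: mc.
Qed.
Definition mkL2 : L2space :=
  HB.pack c (isFinLebesgue.Build _ _ _ mu 2%:E (lee1n 2) c cfin).

Lemma mkL2E : (mkL2 : T -> R) = h %[ae mu].
Proof. exact: ch. Qed.
End mkL2.

HB.instance Definition _ := gen_eqMixin L2space.
HB.instance Definition _ := gen_choiceMixin L2space.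

Let Lfun_sub := Lfun_submod_closed mu (lee1n 2).

Definition zeroL2 : L2space := mkL2 (proj1 Lfun_sub).
Definition oppL2 (f : L2space) : L2space := mkL2 (Lfun_oppr_closed (L2P f)).
Definition addL2 (f g : L2space) : L2space :=
  mkL2 (proj2 (Lfun_addr_closed mu (lee1n 2)) f g (L2P f) (L2P g)).
Definition scaleL2 (a : R) (f : L2space) : L2space :=
  mkL2 (Lfun_scale a (ler1n R 2) (L2P f)).

Lemma zeroL2E : (zeroL2 : T -> R) = cst 0 %[ae mu]. Proof. exact: mkL2E. Qed.
Lemma oppL2E f : (oppL2 f : T -> R) = (fun x => - f x) %[ae mu].
Proof. exact: mkL2E. Qed.
Lemma addL2E f g : (addL2 f g : T -> R) = (fun x => f x + g x) %[ae mu].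
Proof. exact: mkL2E. Qed.
Lemma scaleL2E a f : (scaleL2 a f : T -> R) = (fun x => a * f x) %[ae mu].
Proof. apply: ae_eq_trans (mkL2E _) _; apply: aeW => x _ /=; exact: mulrC. Qed.

Lemma addL2A : associative addL2.
Proof.
move=> f g h; apply: L2_eqP.
apply: filterS3 (addL2E f (addL2 g h)) (addL2E g h)
  (filterI (addL2E (addL2 f g) h) (addL2E f g)) => x.
by move=> + + [+ +] _ => ->// ->// ->// ->//; rewrite addrA.
Qed.
Lemma addL2C : commutative addL2.
Proof.
move=> f g; apply: L2_eqP.
by apply: filterS2 (addL2E f g) (addL2E g f) => x + + _ => ->// ->//; rewrite addrC.
Qed.
Lemma add0L2 : left_id zeroL2 addL2.
Proof.
move=> f; apply: L2_eqP.
by apply: filterS2 (addL2E zeroL2 f) zeroL2E => x + + _ => ->// ->//; rewrite add0r.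
Qed.
Lemma addNL2 : left_inverse zeroL2 oppL2 addL2.
Proof.
move=> f; apply: L2_eqP.
apply: filterS3 (addL2E (oppL2 f) f) (oppL2E f) zeroL2E => x.
by move=> + + + _ => ->// ->// ->//; rewrite addNr.
Qed.

HB.instance Definition _ :=
  GRing.isZmodule.Build L2space addL2A addL2C add0L2 addNL2.

Let scaleA a b f : scaleL2 a (scaleL2 b f) = scaleL2 (a * b) f.
Proof.
apply: L2_eqP.
apply: filterS3 (scaleL2E a (scaleL2 b f)) (scaleL2E b f) (scaleL2E (a * b) f) => x.
by move=> + + + _ => ->// ->// ->//; rewrite mulrA.
Qed.
Let scale1 : left_id 1 scaleL2.
Proof.
move=> f; apply: L2_eqP.
by apply: filterS (scaleL2E 1 f) => x + _ => ->//; rewrite mul1r.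
Qed.
Let scaleDr : right_distributive scaleL2 +%R.
Proof.
move=> a f g; apply: L2_eqP.
apply: filterS3 (filterI (scaleL2E a (f + g)) (addL2E f g))
  (filterI (scaleL2E a f) (scaleL2E a g)) (addL2E (scaleL2 a f) (scaleL2 a g)) => x.
by move=> [+ +] [+ +] + _ => ->// ->// + + ->// => ->// ->//; rewrite mulrDr.
Qed.
Let scaleDl f : {morph scaleL2^~ f : a b / a + b}.
Proof.
move=> a b; apply: L2_eqP.
apply: filterS3 (scaleL2E (a + b) f) (filterI (scaleL2E a f) (scaleL2E b f))
  (addL2E (scaleL2 a f) (scaleL2 b f)) => x.
by move=> + [+ +] + _ => ->// + + ->// => ->// ->//; rewrite mulrDl.
Qed.

HB.instance Definition _ := GRing.Zmodule_isLmodule.Build R L2space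
  scaleA scale1 scaleDr scaleDl.

Definition L2norm (f : L2space) : R := fine ('N[mu]_2%:E[EFin \o f])%E.

Lemma L2normE f : (L2norm f)%:E = ('N[mu]_2%:E[EFin \o f])%E.
Proof.
rewrite /L2norm fineK// ge0_fin_numE ?Lnorm_ge0//.
exact: (set_mem (sub_Lfun_finLfun (L2P f))).
Qed.

Let normD f g : L2norm (f + g) <= L2norm f + L2norm g.
Proof.
rewrite -lee_fin EFinD !L2normE.
rewrite (ae_eq_Lnorm2 (measurable_L2fun _) _ (addL2E f g)).
  exact: eminkowski (measurable_L2fun f) (measurable_L2fun g) (lee1n 2).
by apply: measurable_funD; exact: measurable_L2fun.
Qed.

Let normZ a f : L2norm (a *: f) = `|a| * L2norm f.
Proof.
apply: EFin_inj; rewrite EFinM !L2normE.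
rewrite (ae_eq_Lnorm2 (measurable_L2fun _) _ (scaleL2E a f)).
  exact: (LnormZ (Lfun_Sub (lee1n 2) (L2P f)) a).
by apply: measurable_funM => //; exact: measurable_L2fun.
Qed.

Let norm0_eq0 f : L2norm f = 0 -> f = 0.
Proof.
move=> f0; apply: L2_eqP; apply: ae_eq_trans (ae_eq_sym zeroL2E).
exact: (fine_Lnormr_eq0 (f0 : fine ('N[mu]_2%:E[EFin \o Lfun_Sub (lee1n 2) (L2P f)])%E = 0)).
Qed.

HB.instance Definition _ := Lmodule_isNormed.Build R L2space
  normD normZ norm0_eq0.

Definition L2dot (f g : L2space) : R := \int[mu]_x (f x * g x).

Lemma L2dotE f : L2dot f f = `|f| ^+ 2.
Proof.
rewrite [RHS](_ : _ = L2norm f ^+ 2)//; apply: EFin_inj.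
rewrite -powR_mulrn ?fine_ge0 ?Lnorm_ge0// -poweR_EFin L2normE poweR_Lnorm//.
rewrite /L2dot /Rintegral; under eq_integral do rewrite -expr2.
rewrite fineK; last first.
  apply/integrable_fin_num => //.
  exact: (Lfun2_integrable_sqr (L2P f)).
by apply: eq_integral => x _ /=; rewrite powR_mulrn// real_normK ?num_real.
Qed.

End L2.

(* Unbounded operators in a normed space V with inner product dot; an
   operator is given by its domain and a function whose values outside the
   domain are irrelevant. *)
Record unbounded_op (V : Type) := UnboundedOp {
  op_dom : set V ;
  op_fun :> V -> V
}.

Section unbounded_operators.
Variables (R : realType) (V : normedModType R) (dot : V -> V -> R).
Implicit Types (A B : unbounded_op V) (K : set V).

Definition op_range A : set V := A @` op_dom A.

Definition op_comp A B : unbounded_op V :=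
  UnboundedOp (op_dom B `&` B @^-1` op_dom A) (A \o B).

Definition op_restrict A K : unbounded_op V :=
  UnboundedOp (op_dom A `&` K) A.

Definition op_inverse A : unbounded_op V :=
  UnboundedOp (op_range A) (fun f => xget 0 [set u | op_dom A u /\ A u = f]).

(* The graph of the adjoint of A, regarded as an operator in the Hilbert
   space K. *)
Definition adjoint_graph K A (v w : V) : Prop :=
  [/\ K v, K w & forall u, op_dom A u -> dot (A u) v = dot u w].

Definition selfadjoint K A : Prop :=
  [/\ op_dom A `<=` K, op_range A `<=` K, K `<=` closure (op_dom A) &
      forall v w, adjoint_graph K A v w <-> (op_dom A v /\ A v = w)].

Definition positive_op A : Prop :=
  forall u, op_dom A u -> u != 0 -> 0 < dot (A u) u.

Definition op_norm A : \bar R :=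
  ereal_sup [set `|A f|%:E | f in op_dom A `&` [set f | `|f| <= 1]].

End unbounded_operators.

Record domain (R : realType) (N : nat) := Domain {
  domain_set :> set 'rV[R]_N ;
  domain_open : open domain_set ;
  domain_connected : connected domain_set ;
  domain_neq0 : domain_set !=set0
}.

Section smooth_functions.
Variables (R : realType) (N : nat).
Implicit Types phi : 'rV[R]_N -> R.

Definition partial (i : 'I_N) phi : 'rV[R]_N -> R :=
  fun x => 'D_(delta_mx 0 i) phi x.

Definition partials (s : seq 'I_N) phi : 'rV[R]_N -> R := foldr partial phi s.

Definition classical_laplacian phi : 'rV[R]_N -> R :=
  fun x => \sum_(i < N) partial i (partial i phi) x.

Definition smooth phi : Prop := forall s : seq 'I_N,
  continuous (partials s phi) /\
  forall (i : 'I_N) x, derivable (partials s phi) x (delta_mx 0 i).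

(* Smooth functions with compact support in Omega, extended by zero. *)
Definition test_function (Omega : set 'rV[R]_N) phi : Prop :=
  [/\ smooth phi, compact (closure [set x | phi x != 0]) &
      closure [set x | phi x != 0] `<=` Omega].

End smooth_functions.

Section sobolev.
Variables (R : realType) (N : nat) (Omega : domain R N).

Definition lebesgue_on : {measure set 'rV[R]_N -> \bar R} :=
  mrestr (lebesgue_rV R N) (rV_open_measurable (@domain_open _ _ Omega)).

Definition L2 := L2space lebesgue_on.
Implicit Types u v : L2.

(* The order of the indices in s is immaterial, as phi is smooth. *)
Definition weak_partials (s : seq 'I_N) u v : Prop :=
  forall phi, test_function Omega phi ->
  \int[lebesgue_on]_x (u x * partials s phi x) =
  (-1) ^+ size s * \int[lebesgue_on]_x (v x * phi x).

Definition weak_laplacian u v : Prop :=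
  forall phi, test_function Omega phi ->
  \int[lebesgue_on]_x (u x * classical_laplacian phi x) =
  \int[lebesgue_on]_x (v x * phi x).

(* The distributional derivatives, with value 0 if they are not in L2. *)
Definition dpartials (s : seq 'I_N) u : L2 :=
  xget 0 [set v | weak_partials s u v].

Definition laplacian u : L2 := xget 0 [set v | weak_laplacian u v].

Definition sobolev (k : nat) : set L2 :=
  [set u | forall s : seq 'I_N, (size s <= k)%N -> exists v, weak_partials s u v].

(* The square root of the sum over m <= k of the squared L2-norms of the m-th
   derivative tensors: a mixed derivative counts once for each ordering of its
   indices. *)
Definition sobolev_norm (k : nat) u : R :=
  Num.sqrt (\sum_(m < k.+1) \sum_(s : m.-tuple 'I_N) `|dpartials s u| ^+ 2).

Definition test_classes : set L2 :=
  [set v | exists2 phi, test_function Omega phi &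
    (v : 'rV[R]_N -> R) = phi %[ae lebesgue_on]].

(* The closure of the test functions for sobolev_norm k. *)
Definition sobolev0 (k : nat) : set L2 :=
  [set u | sobolev k u /\
    forall e, 0 < e -> exists2 v, test_classes v & sobolev_norm k (u - v) < e].

Definition grad_norm u : R :=
  Num.sqrt (\sum_(i < N) `|dpartials [:: i] u| ^+ 2).

Definition friedrichs_constants : set R :=
  [set c | 0 < c /\ forall u, sobolev0 1 u -> `|u| <= c * grad_norm u].

Definition friedrichs_admissible : Prop := friedrichs_constants !=set0.

Definition friedrichs_const : R := inf friedrichs_constants.

Definition H_laplacian : set L2 := [set u | exists v, weak_laplacian u v].

Definition harmonic : set L2 := [set u | weak_laplacian u 0].

Definition harmonic_orth : set L2 :=
  [set u | forall h, harmonic h -> L2dot u h = 0].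

Definition laplace0_op : unbounded_op L2 :=
  UnboundedOp (sobolev0 2) (fun u => - laplacian u).

Definition laplace_op : unbounded_op L2 :=
  UnboundedOp H_laplacian (fun u => - laplacian u).

Definition neumann_bilaplacian : unbounded_op L2 :=
  op_comp laplace0_op laplace_op.

Definition reduced_neumann_bilaplacian : unbounded_op L2 :=
  op_restrict neumann_bilaplacian harmonic_orth.

End sobolev.

Arguments sobolev {R N} Omega k _.
Arguments test_classes {R N} Omega _.
Arguments sobolev0 {R N} Omega k _.
Arguments friedrichs_constants {R N} Omega _.
Arguments H_laplacian {R N} Omega _.
Arguments harmonic {R N} Omega _.
Arguments harmonic_orth {R N} Omega _.

(* Main.v *)
Require Import Defs.
From mathcomp Require Import all_boot all_order all_algebra.
From mathcomp Require Import all_classical all_reals all_analysis.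
From mathcomp Require Import measurable_realfun ring lra.
Set Implicit Arguments.
Unset Strict Implicit.
Unset Printing Implicit Defensive.
Import Order.TTheory GRing.Theory Num.Theory.
Import numFieldNormedType.Exports.
Local Open Scope classical_set_scope.
Local Open Scope ring_scope.

(** The Laplacian on [sobolev0 2] is injective with closed range [M]: for test
    functions the Friedrichs inequality and [|grad phi|^2 = - <phi, Delta phi>]
    give [|phi| <= c^2 |Delta phi|], and integrating by parts twice gives
    [sum_ij |d_ij phi|^2 = |Delta phi|^2], so that all derivatives of order at
    most two are controlled by [Delta phi].  Since Green's formula
    [<Delta phi, u> = <phi, Delta u>] holds for [phi] in [sobolev0 2] and every
    [u] with [Delta u] in [L2], the orthogonal complement of [M] consists of the
    harmonic functions and [harmonic_orth = M].  The Riesz representation of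
    [Delta phi |-> <w, phi>] in the Hilbert space [M] solves [Delta u = w] with
    [u] in [M].  Solving [f = Delta w] with [w] in [sobolev0 2] and then
    [Delta u = w] inverts the reduced bi-Laplacian, which is symmetric by Green's
    formula, and a symmetric operator that is onto is selfadjoint.

    That distributional derivatives are unique rests on the products of one
    dimensional bump functions, which converge to the indicators of boxes, and on
    Dynkin's lemma. *)

(** * The Hilbert space L2 *)

(** On an arbitrary domain there are no traces and no regularity up to the boundary. Every boundary
    condition is therefore membership in [sobolev0], and every identity is proved for test functions
    and then passed to the limit. A function in [H_laplacian] need not have its gradient in [L2], so
    the Friedrichs inequality does not apply to it. On [harmonic_orth] duality takes its place: with
    [u = Delta p] and [p] in [sobolev0 2], [|u|^2 = <p, Delta u> <= c^2 |u| |Delta u|]. This is why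
    [c^2] serves both [u] and [Delta u], and [c^4] is the product of the two bounds. The second
    derivatives have to be controlled because [sobolev0 2] is a closure in the full second order
    norm: a bound of [phi] alone by [Delta phi] would not keep limits inside it. Since [laplacian]
    and [dpartials] are picked by [xget], even their linearity depends on the uniqueness of
    distributional derivatives. *)

Section L2_hilbert.
Context d (T : measurableType d) (R : realType).
Variable mu : {measure set T -> \bar R}.
Local Notation V := (L2space mu).
Implicit Types f g h : V.

Lemma integrable_L2M f g : mu.-integrable setT (EFin \o (fun x => f x * g x)).
Proof. exact/Lfun1_integrable/(Lfun2_mul_Lfun1 (L2P f) (L2P g)). Qed.

Lemma L2dotC f g : L2dot f g = L2dot g f.
Proof. by rewrite /L2dot; congr Rintegral; apply/funext => x; rewrite mulrC. Qed.

Lemma ae_eq_Rintegral (F G : T -> R) :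
  measurable_fun setT F -> measurable_fun setT G -> F = G %[ae mu] ->
  \int[mu]_x F x = \int[mu]_x G x.
Proof.
move=> mF mG FG; congr fine; apply: ae_eq_integral => //.
- exact/measurable_EFinP.
- exact/measurable_EFinP.
- by apply: filterS FG => x /= + xT => ->.
Qed.

Lemma measurable_L2M f g : measurable_fun setT (fun x => f x * g x).
Proof. by apply: measurable_funM; exact: measurable_L2fun. Qed.

Lemma L2dotDl f g h : L2dot (f + g) h = L2dot f h + L2dot g h.
Proof.
rewrite /L2dot -RintegralD//; try exact: integrable_L2M.
apply: ae_eq_Rintegral; first exact: measurable_L2M.
  by apply: measurable_funD; exact: measurable_L2M.
by apply: filterS (addL2E f g) => x /= + xT => ->//; rewrite mulrDl.
Qed.

Lemma L2dotZl a f h : L2dot (a *: f) h = a * L2dot f h.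
Proof.
rewrite /L2dot -RintegralZl//; last exact: integrable_L2M.
apply: ae_eq_Rintegral; first exact: measurable_L2M.
  by apply: measurable_funM => //; exact: measurable_L2M.
by apply: filterS (scaleL2E a f) => x /= + xT => ->//; rewrite mulrA.
Qed.

Lemma L2dot_classE f (F : T -> R) : measurable_fun setT F ->
  (f : T -> R) = F %[ae mu] -> forall g, L2dot g f = \int[mu]_x (g x * F x).
Proof.
move=> mF fF g; apply: ae_eq_Rintegral.
- exact: measurable_L2M.
- by apply: measurable_funM => //; exact: measurable_L2fun.
- by apply: filterS fF => x /= + xT => ->.
Qed.

Lemma subL2E f g : ((f - g : V) : T -> R) = (fun x => f x - g x) %[ae mu].
Proof.
by apply: filterS2 (addL2E f (- g)) (oppL2E g) => x + + xT => ->// ->.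
Qed.

Lemma integral_L2_dist f g :
  (\int[mu]_x ((f x - g x) ^+ 2)%:E = (`|f - g| ^+ 2)%:E)%E.
Proof.
rewrite -L2dotE /L2dot fineK; last first.
  by apply: integrable_fin_num => //; exact: integrable_L2M.
apply: ae_eq_integral => //.
- apply/measurable_EFinP; apply: measurable_funX; apply: measurable_funB;
  exact: measurable_L2fun.
- apply/measurable_EFinP; exact: measurable_L2M.
by apply: filterS (subL2E f g) => x /= + xT => ->//; rewrite expr2.
Qed.

Lemma Lfun2_sqr_fin (F : T -> R) : measurable_fun setT F ->
  (\int[mu]_x (F x ^+ 2)%:E < +oo)%E -> F \in Lfun mu 2%:E.
Proof.
move=> mF F2; rewrite inE; apply/andP; split; rewrite inE//=.
rewrite /finite_norm unlock /Lnorm/=; apply: poweR_lty.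
apply: le_lt_trans F2; rewrite le_eqVlt; apply/orP; left; apply/eqP.
by apply: eq_integral => x _ /=; rewrite powR_mulrn// real_normK// num_real.
Qed.

Lemma limn_einf_le (u : nat -> \bar R) (c : \bar R) N :
  (forall n, (N <= n)%N -> (u n <= c)%E) -> (limn_einf u <= c)%E.
Proof.
move=> uc; apply: (le_trans (limn_einf_sup u)).
rewrite /limn_esup /limf_esup.
apply: (@le_trans _ _ (ereal_sup (u @` [set n | (N <= n)%N]))).
  by apply: ereal_inf_lbound => /=; exists [set n | (N <= n)%N] => //; exact: nbhs_infty_ge.
by apply: ub_ereal_sup => _ [n /= Nn <-]; exact: uc.
Qed.

(** The weighted squares [2^k (v_(k+1) - v_k)^2] have summable integrals, so their sum is finite
    almost everywhere. The inequality [|t| <= 2^-k + 2^k t^2] then makes the increments absolutely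
    summable at almost every point. *)
Let fast_cauchy_ae_cvg (v : nat -> V) :
  (forall k, `|v k.+1 - v k| <= (2 ^+ k.+1)^-1) ->
  {ae mu, forall x, cvgn (fun k => v k x)}.
Proof.
move=> vk.
pose a k x := 2 ^+ k * (v k.+1 x - v k x) ^+ 2.
have a0 k x : 0 <= a k x by apply: mulr_ge0; [apply: exprn_ge0; rewrite ler0n|exact: sqr_ge0].
have mvd k : measurable_fun setT (fun x => (v k.+1 x - v k x) ^+ 2).
  by apply: measurable_funX; apply: measurable_funB; exact: measurable_L2fun.
have ma k : measurable_fun setT (EFin \o a k).
  by apply/measurable_EFinP; apply: measurable_funM.
have ia k : (\int[mu]_x (a k x)%:E <= (1 / (2 ^ k.+1)%:R)%:E)%E.
  under eq_integral do rewrite EFinM.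
  rewrite ge0_integralZl//; last 2 first.
    exact/measurable_EFinP.
    by move=> x _; rewrite lee_fin sqr_ge0.
  rewrite integral_L2_dist -EFinM lee_fin.
  have p0 : (0 : R) < 2 ^+ k.+1 by rewrite exprn_gt0.
  have h : `|v k.+1 - v k| ^+ 2 <= ((2 ^+ k.+1)^-1) ^+ 2.
    by rewrite ler_pXn2r ?nnegrE ?invr_ge0 ?(ltW p0).
  apply: (@le_trans _ _ (2 ^+ k * ((2 ^+ k.+1)^-1) ^+ 2)).
    by rewrite ler_pM2l// exprn_gt0.
  rewrite natrX; have k0 : (0 : R) < 2 ^+ k by rewrite exprn_gt0.
  rewrite exprS in p0 *.
  rewrite -subr_ge0 (_ : _ - _ = (2 ^+ k)^-1 / 4); first by rewrite divr_ge0// invr_ge0 ltW.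
  by field; rewrite gt_eqF.
have ifin : (\int[mu]_x (\sum_(0 <= k <oo) (a k x)%:E) < +oo)%E.
  rewrite integral_nneseries//; last by move=> *; rewrite lee_fin.
  apply: (@le_lt_trans _ _ (1%:E)); last exact: ltry.
  apply: le_trans (@epsilon_trick0 R 1 xpredT _) => //.
  apply: lee_nneseries => // n _ _; apply: integral_ge0 => x _.
  by rewrite lee_fin.
have : mu.-integrable setT (fun x => (\sum_(0 <= k <oo) (a k x)%:E))%E.
  apply/integrableP; split.
      apply: ge0_emeasurable_sum => [k x _ _|k _]; [by rewrite lee_fin|exact: ma].
  rewrite (eq_integral (fun x => \sum_(0 <= k <oo) (a k x)%:E)%E)// => x _.
  by rewrite gee0_abs//; apply: nneseries_ge0 => *; rewrite lee_fin.
move=> /(integrable_ae measurableT); apply: filterS => x /(_ I) xfin.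
have ca : cvgn (series (a ^~ x)).
  apply: nnseries_is_cvg => [i|]; first exact: a0.
  by rewrite -ge0_fin_numE// nneseries_ge0// => *; rewrite lee_fin.
have cg : cvgn (series (geometric 1 (2^-1 : R))).
  by apply: is_cvg_geometric_series; rewrite ger0_norm// invf_lt1// ltr1n.
have cd : cvgn [normed series (fun k => v k.+1 x - v k x)].
  apply: (@series_le_cvg R _ (geometric 1 (2^-1 : R) \+ a ^~ x)) => //=.
  - by move=> n; rewrite addr_ge0//= mul1r exprn_ge0 ?invr_ge0 ?ler0n.
  - move=> n; rewrite /a mul1r exprVn.
    have k0 : (0 : R) < 2 ^+ n by rewrite exprn_gt0.
    set t := v _ x - v _ x; rewrite -(real_normK (num_real t)).
    set w := `|t|; set y := (2 ^+ n) in k0 *.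
    have : 0 <= (w * y - 2^-1) ^+ 2 / y by rewrite divr_ge0 ?sqr_ge0 ?ltW.
    rewrite (_ : (_ - _) ^+ 2 / y = w ^+ 2 * y - w + y^-1 / 4); last by field; rewrite gt_eqF.
    have : 0 < y^-1 by rewrite invr_gt0.
    by lra.
  - by rewrite -[X in cvgn X]/(series _) seriesD; apply: is_cvgD.
have := normed_cvg cd; rewrite -[X in series X]/(telescope (fun k => v k x)).
rewrite telescopeK => /(is_cvgD (is_cvg_cst (v 0%N x))) h.
rewrite (_ : (fun k => v k x) = (fun=> v 0%N x) + [sequence v n x - v 0%N x]_n)//.
by apply/funext => n; rewrite /= addrC subrK.
Qed.

(* Riesz-Fischer, through a rapidly converging subsequence and Fatou's lemma. *)
Lemma L2_complete (u : nat -> V) :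
  (forall e, 0 < e -> exists N, forall m n,
     (N <= m)%N -> (N <= n)%N -> `|u m - u n| <= e) ->
  exists f, forall e, 0 < e -> exists N, forall n, (N <= n)%N -> `|u n - f| <= e.
Proof.
move=> cu.
have /choice[M MP] : forall k, exists N, forall m n,
    (N <= m)%N -> (N <= n)%N -> `|u m - u n| <= (2 ^+ k.+1)^-1.
  by move=> k; apply: cu; rewrite invr_gt0 exprn_gt0.
(* Partial sums of the thresholds are monotone, so [s k] and [s k.+1] both lie beyond [M k]. *)
pose s k := (\sum_(j < k.+1) M j)%N.
have sM k : (M k <= s k)%N by rewrite /s big_ord_recr/= leq_addl.
have sS k : (M k <= s k.+1)%N.
  by rewrite (leq_trans (sM k))// /s [leqRHS]big_ord_recr/= leq_addr.
pose v k := u (s k).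
have vae : {ae mu, forall x, cvgn (fun k => v k x)}.
  by apply: fast_cauchy_ae_cvg => k; exact: MP.
(* The upper limit is measurable everywhere and equals the limit almost everywhere; its values on
   the exceptional null set are immaterial. *)
pose F x := fine (limn_esup (fun k => (v k x)%:E)).
have mF : measurable_fun setT F.
  apply: (@measurableT_comp _ _ _ _ _ _ (@fine R)) => //.
  apply: measurable_fun_limn_esup => n; apply/measurable_EFinP.
  exact: measurable_L2fun.
have Fae : {ae mu, forall x, (v k x @[k --> \oo] --> F x)}.
  apply: filterS vae => x /cvg_ex[l vl].
  suff -> : F x = l by [].
  have vlE : (fun k => (v k x)%:E) @ \oo --> l%:E by apply: cvg_EFin => //; exact: nearW.
  by rewrite /F (cvg_limn_einf_sup vlE).2.
have bound n e : 0 <= e -> (exists N, forall k, (N <= k)%N -> `|u n - v k| <= e) ->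
    (\int[mu]_x ((u n x - F x) ^+ 2)%:E <= (e ^+ 2)%:E)%E.
  move=> e0 [N Ne].
  have mG k : measurable_fun setT (fun x => ((u n x - v k x) ^+ 2)%:E).
    apply/measurable_EFinP; apply: measurable_funX.
    by apply: measurable_funB; exact: measurable_L2fun.
  rewrite (@ge0_ae_eq_integral _ _ _ _ _ _
    (fun x => limn_einf (fun k => ((u n x - v k x) ^+ 2)%:E)))//.
  - apply: (le_trans (fatou mu measurableT mG _)).
      by move=> k x _; rewrite lee_fin sqr_ge0.
    apply: (@limn_einf_le _ _ N) => k Nk; rewrite integral_L2_dist lee_fin.
    by rewrite ler_pXn2r ?nnegrE//; exact: Ne.
  - apply/measurable_EFinP; apply: measurable_funX.
    by apply: measurable_funB => //; exact: measurable_L2fun.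
  - rewrite /limn_einf; apply: measurableT_comp => //.
    apply: measurable_fun_limn_esup => k.
    exact: measurableT_comp.
  - by move=> x _; rewrite lee_fin sqr_ge0.
  - move=> x _; have h : (0 <= - limn_esup (fun k => - ((u n x - v k x) ^+ 2)%:E))%E.
      rewrite oppe_ge0 /limn_esup /limf_esup.
      apply: (@le_trans _ _ (ereal_sup ((fun k => - ((u n x - v k x) ^+ 2)%:E)%E @` setT))).
        by apply: ereal_inf_lbound => /=; exists setT => //; exact: filterT.
      by apply: ub_ereal_sup => _ [k _ <-]; rewrite oppe_le0 lee_fin sqr_ge0.
    exact: h.
  - apply: filterS Fae => x vx _ /=.
    have : (fun k => ((u n x - v k x) ^+ 2)%:E) @ \oo --> ((u n x - F x) ^+ 2)%:E.
      apply: cvg_EFin; first exact: nearW.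
      by rewrite expr2; under eq_fun do rewrite expr2; apply: cvgM;
        apply: cvgB => //; exact: cvg_cst.
    by move=> /cvg_limn_einf_sup[-> _].
have key e : 0 < e -> exists N, forall n, (N <= n)%N ->
    (\int[mu]_x ((u n x - F x) ^+ 2)%:E <= (e ^+ 2)%:E)%E.
  move=> e0; have [K _ /(_ K (leqnn K)) /= Ke] := near_infty_natSinv_lt (PosNum e0).
  exists (M K) => n Mn; apply: bound; first exact: ltW.
  exists K => k Kk; apply: (@le_trans _ _ (2 ^+ K.+1)^-1).
    apply: MP => //; apply: leq_trans (sM K) _.
    by rewrite /s -(subnKC Kk) -addSn big_split_ord /= leq_addr.
  apply: le_trans (ltW Ke); rewrite lef_pV2 ?posrE ?exprn_gt0//.
  by rewrite -natrX ler_nat ltnW// ltn_expl.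
have [N0 N0P] := key _ ltr01.
have FL : F \in Lfun mu 2%:E.
  have D : (fun x => u N0 x - F x) \in Lfun mu 2%:E.
    apply: Lfun2_sqr_fin; last by apply: le_lt_trans (N0P _ (leqnn _)) _; exact: ltry.
    by apply: measurable_funB => //; exact: measurable_L2fun.
  (* [F] is square integrable as the difference of [u N0] and [u N0 - F]. *)
  rewrite (_ : F = (u N0 : T -> R) \+ (\- (fun x => u N0 x - F x))).
    have [_ h] := Lfun_addr_closed mu (lee1n 2).
    by apply: h; [exact: L2P|exact: Lfun_oppr_closed].
  by apply/funext => x /=; rewrite opprB addrC subrK.
exists (mkL2 FL) => e e0; have [N NP] := key e e0; exists N => n Nn.
rewrite -(@ler_pXn2r _ 2) ?nnegrE ?(ltW e0)// -lee_fin -integral_L2_dist.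
apply: le_trans (NP n Nn); rewrite le_eqVlt; apply/orP; left; apply/eqP.
apply: ae_eq_integral => //.
- apply/measurable_EFinP; apply: measurable_funX; apply: measurable_funB;
  exact: measurable_L2fun.
- apply/measurable_EFinP; apply: measurable_funX.
  by apply: measurable_funB => //; exact: measurable_L2fun.
- by apply: filterS (mkL2E FL) => x /= + xT => ->.
Qed.

End L2_hilbert.

Lemma natSinv_le (R : realType) (e : R) : 0 < e ->
  exists N, forall n, (N <= n)%N -> n.+1%:R^-1 <= e.
Proof.
move=> e0; have [N _ NP] := near_infty_natSinv_lt (PosNum e0).
by exists N => n Nn; apply: ltW; exact: NP.
Qed.

(** * Riesz representation and orthogonal projection in a complete inner product space *)

Section hilbert.
Variables (R : realType) (V : normedModType R) (dot : V -> V -> R).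
Hypothesis dotC : forall x y, dot x y = dot y x.
Hypothesis dotDl : forall x y z, dot (x + y) z = dot x z + dot y z.
Hypothesis dotZl : forall a x y, dot (a *: x) y = a * dot x y.
Hypothesis dotE : forall x, dot x x = `|x| ^+ 2.

Lemma dotDr x y z : dot x (y + z) = dot x y + dot x z.
Proof. by rewrite dotC dotDl !(dotC x). Qed.

Lemma dotZr a x y : dot x (a *: y) = a * dot x y.
Proof. by rewrite dotC dotZl (dotC x). Qed.

Lemma dotNl x y : dot (- x) y = - dot x y.
Proof. by rewrite -scaleN1r dotZl mulN1r. Qed.

Lemma dotNr x y : dot x (- y) = - dot x y.
Proof. by rewrite dotC dotNl dotC. Qed.

Lemma dotBl x y z : dot (x - y) z = dot x z - dot y z.
Proof. by rewrite dotDl dotNl. Qed.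

Lemma dotBr x y z : dot x (y - z) = dot x y - dot x z.
Proof. by rewrite dotDr dotNr. Qed.

Lemma dot0l x : dot 0 x = 0.
Proof. by rewrite -(scale0r 0) dotZl mul0r. Qed.

Lemma dot0r x : dot x 0 = 0.
Proof. by rewrite dotC dot0l. Qed.

Lemma sqr_normD x y : `|x + y| ^+ 2 = `|x| ^+ 2 + 2 * dot x y + `|y| ^+ 2.
Proof. by rewrite -!dotE dotDl !dotDr (dotC y x); ring. Qed.

(** Cauchy-Schwarz: expand [|x + t y|^2 >= 0] at its minimum [t = - <x, y> / |y|^2]. *)
Lemma dot_normM x y : `|dot x y| <= `|x| * `|y|.
Proof.
have [->|y0] := eqVneq y 0; first by rewrite dot0r !normr0 mulr0.
have ny : 0 < `|y| by rewrite normr_gt0.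
rewrite -(@ler_pXn2r _ 2) ?nnegrE ?mulr_ge0// real_normK ?num_real//.
have := sqr_ge0 (`|x + (- dot x y / `|y| ^+ 2) *: y|).
rewrite sqr_normD dotZr normrZ [(`|_ / _| * _) ^+ 2]exprMn real_normK ?num_real//.
rewrite exprMn -subr_ge0 => h.
have : 0 <= (`|y| ^+ 2) * (`|x| ^+ 2 - (dot x y) ^+ 2 / `|y| ^+ 2).
  apply: mulr_ge0; first exact: sqr_ge0.
  by move: h; congr (0 <= _); field; rewrite gt_eqF.
by congr (0 <= _); field; rewrite gt_eqF.
Qed.

Lemma closure_normP (M : set V) x :
  closure M x <-> forall e, 0 < e -> exists2 m, M m & `|x - m| < e.
Proof.
split=> [Mx e e0|h B /nbhs_ballP[e /= e0 xeB]].
  have [m [Mm]] := Mx _ (nbhsx_ballx x e e0).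
  by rewrite -ball_normE => xm; exists m.
have [m Mm xm] := h _ e0; exists m; split=> //; apply: xeB.
by rewrite -ball_normE.
Qed.

Definition subspace_pred (M : set V) :=
  M 0 /\ forall a x y, M x -> M y -> M (a *: x + y).

Lemma subspaceN M x : subspace_pred M -> M x -> M (- x).
Proof. by move=> [M0 h] Mx; rewrite -[- x]addr0 -scaleN1r; exact: h. Qed.

Lemma subspaceB M x y : subspace_pred M -> M x -> M y -> M (x - y).
Proof.
by move=> sM Mx My; rewrite addrC -scaleN1r; apply: (sM.2).
Qed.

Lemma subspace_closure M : subspace_pred M -> subspace_pred (closure M).
Proof.
move=> [M0 h]; split=> [|a x y /closure_normP Mx /closure_normP My].
  exact: subset_closure.
apply/closure_normP => e e0.
have a1 : 0 < `|a| + 1 by rewrite ltr_wpDl.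
have [m Mm xm] := Mx (e / (2 * (`|a| + 1))) (divr_gt0 e0 (mulr_gt0 (ltr0Sn _ 1) a1)).
have [n Mn yn] := My (e / 2) (divr_gt0 e0 (ltr0Sn _ 1)).
exists (a *: m + n); first exact: h.
rewrite opprD addrACA -scalerBr (le_lt_trans (ler_normD _ _))// normrZ.
rewrite [e in _ < e]splitr ler_ltD//.
apply: (@le_trans _ _ ((`|a| + 1) * `|x - m|)).
  by rewrite ler_wpM2r// lerDl.
rewrite mulrC -ler_pdivlMr// (le_trans (ltW xm))//.
by rewrite le_eqVlt; apply/orP; left; apply/eqP; field; rewrite gt_eqF.
Qed.

Hypothesis complete : forall u : nat -> V,
  (forall e, 0 < e -> exists N, forall m n,
     (N <= m)%N -> (N <= n)%N -> `|u m - u n| <= e) ->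
  exists f, forall e, 0 < e -> exists N, forall n, (N <= n)%N -> `|u n - f| <= e.

(* The representer minimizes [|m|^2 - 2 l m] over [M]; the parallelogram
   identity makes minimizing sequences Cauchy. *)
Lemma riesz (M : set V) (l : V -> R) (C : R) : subspace_pred M -> closed M ->
  (forall a x y, M x -> M y -> l (a *: x + y) = a * l x + l y) ->
  (forall x, M x -> `|l x| <= C * `|x|) ->
  exists2 r, M r & forall x, M x -> l x = dot x r.
Proof.
move=> sM cM lM lC; have [M0 Mlin] := sM.
have MZ a x : M x -> M (a *: x) by move=> Mx; rewrite -[_ *: _]addr0; exact: Mlin.
have l0 : l 0 = 0.
  by have := lM 1 0 0 M0 M0; rewrite scaler0 add0r mul1r; lra.
pose J x := `|x| ^+ 2 - 2 * l x.
have Jlb : has_inf (J @` M).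
  split; first by exists (J 0), 0.
  (* Completing the square: [|x|^2 - 2 C |x| >= - C^2]. *)
  exists (- C ^+ 2) => _ [x Mx <-]; rewrite /J.
  have := lC _ Mx; have := ler_norm (l x); have := sqr_ge0 (`|x| - C).
  rewrite sqrrB => h1 h2 h3.
  have : C * `|x| = `|x| * C by rewrite mulrC.
  lra.
pose I := inf (J @` M).
have JI x : M x -> I <= J x.
  by move=> Mx; apply: ge_inf; [exact: Jlb.2|exists x].
(* The accuracy is squared so that the parallelogram bound below, which controls squared distances,
   gives distances of order [1 / (n + 1)]. *)
have /choice[m mP] : forall n : nat, exists x, M x /\ J x <= I + (n.+1%:R^-1) ^+ 2.
  move=> n; have n0 : (0 : R) < (n.+1%:R^-1) ^+ 2 by rewrite exprn_gt0// invr_gt0.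
  by have [_ [x Mx <-] xI] := inf_adherent n0 Jlb; exists x; split=> //; exact: ltW.
have Jpar x y : M x -> M y -> `|x - y| ^+ 2 <= 2 * J x + 2 * J y - 4 * I.
  move=> Mx My; have Mxy : M (2^-1 *: x + 2^-1 *: y).
    by apply: (Mlin) => //; exact: MZ.
  have := JI _ Mxy; rewrite /J lM//; last exact: MZ.
  have -> : l (2^-1 *: y) = 2^-1 * l y.
    by rewrite -[_ *: y]addr0 lM// l0 addr0.
  rewrite !sqr_normD normrN dotNr dotZl dotZr !normrZ !exprMn ger0_norm//.
  by move=> h; lra.
have [r mr] : exists f, forall e, 0 < e ->
    exists N, forall n, (N <= n)%N -> `|m n - f| <= e.
  apply: complete => e e0.
  have [N NP] := natSinv_le (divr_gt0 e0 (ltr0Sn _ 1)).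
  exists N => p q Np Nq; have [Mp Jp] := mP p; have [Mq Jq] := mP q.
  rewrite -(@ler_pXn2r _ 2) ?nnegrE ?(ltW e0)//.
  have sq k : (N <= k)%N -> (k.+1%:R^-1) ^+ 2 <= (e / 2) ^+ 2.
    move=> Nk; rewrite ler_pXn2r ?nnegrE//; first exact: NP.
    by rewrite divr_ge0// ltW.
  have := Jpar _ _ Mp Mq; have := sq _ Np; have := sq _ Nq.
  have -> : (e / 2) ^+ 2 = e ^+ 2 / 4 by field.
  move: Jp Jq; move: (_ ^+ 2) (q.+1%:R^-1 ^+ 2) => A B; move: (J _) (J _) => j1 j2.
  by lra.
have Mr : M r.
  apply: cM; apply/closure_normP => e e0.
  have [N NP] := mr _ (divr_gt0 e0 (ltr0Sn _ 1)); exists (m N); first by have [] := mP N.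
  rewrite distrC (le_lt_trans (NP _ (leqnn N)))//.
  by rewrite ltr_pdivrMr// ltr_pMr// ltr1n.
exists r => // x Mx; apply/eqP; rewrite -subr_eq0 -normr_le0; apply/ler_addgt0Pr => e e0.
rewrite add0r.
have x1 : 0 < `|x| + 1 by rewrite ltr_wpDl.
have d0 : 0 < e / (2 * (`|x| + 1)) by rewrite divr_gt0// mulr_gt0.
have h4 : e / (2 * (`|x| + 1)) * `|x| <= e / 2.
  rewrite invfM mulrA -mulrA ger_pMr ?divr_gt0//.
  by rewrite mulrC ler_pdivrMr// mul1r lerDl.
move: (e / (2 * (`|x| + 1))) d0 h4 => D d0 h4.
have [N1 N1P] := natSinv_le d0; have [N2 N2P] := mr _ d0.
pose n := maxn N1 N2; have [Mn Jn] := mP n.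
have a1 : `|dot x (m n) - l x| <= n.+1%:R^-1 * `|x|.
  have [->|x0] := eqVneq x 0.
    have := lC _ M0; rewrite normr0 !mulr0 normr_le0 => /eqP ->.
    by rewrite dot0l subrr normr0.
  have nx : 0 < `|x| by rewrite normr_gt0.
  rewrite -(@ler_pXn2r _ 2) ?nnegrE ?mulr_ge0// real_normK ?num_real// exprMn.
  (* The minimum of [J] on the line [m n + t x]. As [m n] is already within [1 / (n + 1)^2] of the
     infimum, the defect [<x, m n> - l x] is at most [|x| / (n + 1)]. *)
  set t := - (dot x (m n) - l x) / `|x| ^+ 2.
  have := JI _ (Mlin t _ _ Mx Mn); rewrite /J lM// sqr_normD dotZl normrZ exprMn.
  rewrite real_normK ?num_real// => h.
  rewrite -ler_pdivrMr ?exprn_gt0//.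
  have e1 : (dot x (m n) - l x) ^+ 2 / `|x| ^+ 2 =
      - (t ^+ 2 * `|x| ^+ 2 + 2 * t * (dot x (m n) - l x)).
    by rewrite /t; field; rewrite gt_eqF.
  rewrite e1; rewrite /J in Jn; clearbody t I.
  move: Jn; move: (n.+1%:R^-1 ^+ 2) => z Jn.
  lra.
rewrite (_ : l x - dot x r = - (dot x (m n) - l x) + dot x (m n - r)); last first.
  by rewrite dotBr; ring.
apply: (le_trans (ler_normD _ _)); rewrite normrN.
have h1 := N1P n (leq_maxl _ _); have h2 := N2P n (leq_maxr _ _).
have h3 := dot_normM x (m n - r).
have h5 : n.+1%:R^-1 * `|x| <= D * `|x| by rewrite ler_wpM2r.
have h6 : `|x| * `|m n - r| <= `|x| * D by rewrite ler_wpM2l.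
rewrite [_ * D]mulrC in h6.
rewrite [e]splitr; apply: lerD; first exact: le_trans a1 (le_trans h5 h4).
exact: le_trans h3 (le_trans h6 h4).
Qed.

Lemma orth_proj (M : set V) x : subspace_pred M -> closed M ->
  exists2 r, M r & forall y, M y -> dot y (x - r) = 0.
Proof.
move=> sM cM.
have [||r Mr h] := @riesz M (fun y => dot y x) `|x| sM cM.
- by move=> a y z _ _; rewrite dotDl dotZl.
- by move=> y _; rewrite mulrC; exact: dot_normM.
by exists r => // y My; rewrite dotBr h// subrr.
Qed.

(** The residual of the projection of [v] onto the closure of [D] is orthogonal to [D]. It stays in
    [K] because [K] is closed and contains [D]. *)
Lemma dense_of_orth0 (K D : set V) : subspace_pred K -> closed K ->
  subspace_pred D -> D `<=` K ->
  (forall v, K v -> (forall x, D x -> dot x v = 0) -> v = 0) ->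
  K `<=` closure D.
Proof.
move=> sK cK sD DK h v Kv.
have [r Dr rP] := orth_proj v (subspace_closure sD) (@closed_closure _ D).
have Kr : K r by apply: cK; exact: closure_subset Dr.
have : v - r = 0.
  by apply: h => [|x Dx]; [exact: subspaceB|apply: rP; exact: subset_closure].
by move/eqP; rewrite subr_eq0 => /eqP ->.
Qed.

Lemma closed_orth (S : set V) : closed [set v | forall s, S s -> dot v s = 0].
Proof.
move=> v /closure_normP vS s Ss; apply/eqP; rewrite -normr_le0; apply/ler_addgt0Pr => e e0.
rewrite add0r; have s1 : 0 < `|s| + 1 by rewrite ltr_wpDl.
have [w wS vw] := vS (e / (`|s| + 1)) (divr_gt0 e0 s1).
have -> : dot v s = dot (v - w) s by rewrite dotBl (wS _ Ss) subr0.
apply: (le_trans (dot_normM _ _)).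
apply: (@le_trans _ _ (e / (`|s| + 1) * (`|s| + 1))).
  by apply: ler_pM => //; [exact: ltW|rewrite lerDl].
by rewrite divfK// gt_eqF.
Qed.

Lemma subspace_orth (S : set V) : subspace_pred [set v | forall s, S s -> dot v s = 0].
Proof.
split=> [s _|a x y xS yS s Ss]; first exact: dot0l.
by rewrite dotDl dotZl xS// yS// mulr0 addr0.
Qed.

End hilbert.

(** * Smooth test functions *)

Section smooth_real.
Variable R : realType.
Implicit Types (f g : R -> R) (p q : {poly R}).

(** Derivatives are only asserted to exist, so sums, products and compositions are handled by
    induction with no formula for higher derivatives. *)
Fixpoint n_derivable n f : Prop :=
  if n is m.+1 then
    exists g, (forall x : R, is_derive x (1 : R) f (g x)) /\ n_derivable m g
  else True.

Lemma n_derivableW n f : n_derivable n.+1 f -> n_derivable n f.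
Proof.
elim: n f => // n IH f [g [fg ng]]; exists g; split=> //; exact: IH.
Qed.

Lemma n_derivableD n f g : n_derivable n f -> n_derivable n g ->
  n_derivable n (fun x => f x + g x).
Proof.
elim: n f g => // n IH f g [f' [ff' nf']] [g' [gg' ng']].
exists (fun x => f' x + g' x); split; last exact: IH.
by move=> x; exact: is_deriveD.
Qed.

Lemma n_derivableM n f g : n_derivable n f -> n_derivable n g ->
  n_derivable n (fun x => f x * g x).
Proof.
elim: n f g => // n IH f g nf ng.
have [f' [ff' nf']] := nf; have [g' [gg' ng']] := ng.
exists (fun x => f x * g' x + g x * f' x); split; last first.
  by apply: n_derivableD; apply: IH => //; exact: n_derivableW.
by move=> x; exact: is_deriveM.
Qed.

Lemma n_derivable_horner n p : n_derivable n (horner p).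
Proof.
elim: n p => // n IH p; exists (horner p^`()); split=> //.
by move=> x; exact: is_derive_poly.
Qed.

Lemma n_derivable_derive1n f : (forall n, n_derivable n f) ->
  forall n (x : R), derivable (derive1n n f) x 1.
Proof.
move=> nf n; suff : n_derivable 1 (derive1n n f) by move=> [g [fg _]] x; case: (fg x).
have {}nf := nf n.+1; elim: n f nf => // n IH f [g [fg ng]].
rewrite derive1Sn; apply: IH; suff -> : derive1 f = g by [].
by apply/funext => x; rewrite derive1E; exact: derive_val.
Qed.

Definition flat p (t : R) : R := if 0 < t then p.[t^-1] * expR (- t^-1) else 0.

(* With [s = 1/t], the derivative of [p(s) exp(-s)] in [t] is
   [s^2 (p(s) - p'(s)) exp(-s)], so the family is closed under differentiation. *)
Definition flat_deriv p : {poly R} := 'X^2 * (p - p^`()).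

(** Coefficientwise from [s^i <= i! exp(s)]. *)
Lemma horner_expR_bound p : exists2 C, 0 <= C &
  forall s, 0 <= s -> `|p.[s]| <= C * expR s.
Proof.
exists (\sum_(i < size p) `|p`_i| * i`!%:R).
  by apply: sumr_ge0 => i _; rewrite mulr_ge0.
move=> s s0; rewrite horner_coef (le_trans (ler_norm_sum _ _ _))// mulr_suml.
apply: ler_sum => i _; rewrite normrM -mulrA ler_wpM2l// ger0_norm ?exprn_ge0//.
case: (nat_of_ord i) => [|n].
  by rewrite expr0 fact0 mul1r (le_trans _ (expR_ge1Dx s))// lerDl.
rewrite -ler_pdivrMl ?ltr0n ?fact_gt0// mulrC (le_trans _ (expR_ge1Dxn n s0))//.
by rewrite lerDr.
Qed.

(** The exponential bound for ['X^2 * p] at [s = 1/t]. The quadratic decay is what makes the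
    derivative at the origin exist and vanish. *)
Lemma flat_quadratic p : exists2 C, 0 <= C & forall t, `|flat p t| <= C * t ^+ 2.
Proof.
have [C C0 Cp] := horner_expR_bound ('X^2 * p).
exists C => // t; rewrite /flat; case: ifPn => t0; last first.
  by rewrite normr0 mulr_ge0// sqr_ge0.
have ti : 0 < t^-1 by rewrite invr_gt0.
have := Cp _ (ltW ti); rewrite hornerM hornerXn !normrM => h.
rewrite (ger0_norm (expR_ge0 _)) expRN ler_pdivrMr ?expR_gt0//.
move: h; rewrite ger0_norm ?(ltW ti)// -expr2 exprVn ler_pdivrMl ?exprn_gt0//.
by rewrite mulrCA mulrA.
Qed.

Lemma is_derive_flat p (t : R) : is_derive t (1 : R) (flat p) (flat (flat_deriv p) t).
Proof.
have [t0|t0|<-] := ltgtP 0 t.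
- have h : is_derive t (1 : R) (fun u => p.[u^-1] * expR (- u^-1)) (flat (flat_deriv p) t).
    have dV : is_derive t (1 : R) (fun u : R => u^-1) (- t ^- 2 *: (1 : R)).
      by apply: is_deriveV; rewrite gt_eqF.
    have dp := is_derive1_comp (is_derive_poly p t^-1) dV.
    have dN : is_derive t (1 : R) (fun u : R => - u^-1) (- (- t ^- 2 *: (1 : R))).
      exact: is_deriveN.
    have de := @is_derive1_comp R expR (fun u : R => - u^-1) t _ _ (is_derive_expR _) dN.
    apply: is_derive_eq (is_deriveM dp de) _.
    rewrite /flat t0 /flat_deriv hornerM hornerXn hornerD hornerN.
    rewrite /GRing.scale/= /comp; set e := expR _; set a := p.[_]; set b := p^`().[_].
    by field; rewrite gt_eqF.
  apply: near_eq_is_derive h; near=> u; rewrite /flat ifT//.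
  by near: u; exact: lt_nbhsr.
- rewrite {2}/flat ltNge (ltW t0)/=.
  apply: (near_eq_is_derive _ (is_derive_cst (0 : R) t 1)); near=> u; rewrite /flat ifF//.
  apply/negbTE; rewrite -leNgt; apply: ltW.
  by near: u; exact: lt_nbhsl.
(* At the origin the difference quotient is [O(|h|)]; [C + 1] replaces [C] so that it can be divided
   by. *)
- have [C C0 Cp] := flat_quadratic p.
  have c0 : h^-1 *: ((flat p \o shift 0) (h *: (1 : R)) - flat p 0) @[h --> (0 : R)^'] --> (0 : R).
    apply/cvgr0Pnorm_lt => e e0; near=> h.
    have h0 : h != 0 by near: h; exact: nbhs_dnbhs_neq.
    rewrite /= addr0 [flat p 0]/flat ltxx subr0 /GRing.scale/= mulr1 normrM normfV.
    rewrite ltr_pdivrMl ?normr_gt0// (le_lt_trans (Cp _))//.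
    rewrite -(real_normK (num_real h)) expr2 mulrCA ltr_pM2l ?normr_gt0//.
    apply: (@le_lt_trans _ _ ((C + 1) * `|h|)); first by rewrite ler_wpM2r// lerDl.
    rewrite -ltr_pdivlMl ?ltr_wpDl//.
    near: h; apply: dnbhs0_lt.
    by rewrite mulr_gt0 ?invr_gt0 ?ltr_wpDl.
  have -> : flat (flat_deriv p) 0 = 0 by rewrite /flat ltxx.
  apply: DeriveDef; first by apply/cvg_ex; exists 0.
  exact: cvg_lim c0.
Unshelve. all: by end_near. Qed.

Lemma n_derivable_flat_comp n p q : n_derivable n (fun x => flat p q.[x]).
Proof.
elim: n p => // n IH p; exists (fun x => flat (flat_deriv p) q.[x] * q^`().[x]); split.
  by move=> x; exact: is_derive1_comp (is_derive_flat p _) (is_derive_poly q x).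
by apply: n_derivableM => //; exact: n_derivable_horner.
Qed.

(* Tends to the indicator of the interval as [k] grows, staying below it. *)
Definition flat_bump (k : nat) (a b x : R) : R :=
  flat 1 (k.+1%:R%:P * (('X - a%:P) * (b%:P - 'X))).[x].

Lemma bumpE k a b x : flat_bump k a b x =
  if 0 < (x - a) * (b - x) then expR (- (k.+1%:R * ((x - a) * (b - x)))^-1) else 0.
Proof.
have e : (k.+1%:R%:P * (('X - a%:P) * (b%:P - 'X))).[x] = k.+1%:R * ((x - a) * (b - x)).
  by rewrite !hornerE.
by rewrite /flat_bump /flat e hornerC mul1r pmulr_rgt0.
Qed.

Lemma n_derivable_bump k a b n : n_derivable n (flat_bump k a b).
Proof. exact: n_derivable_flat_comp. Qed.

Lemma bump_ge0 k a b x : 0 <= flat_bump k a b x.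
Proof. by rewrite bumpE; case: ifP => // _; exact: expR_ge0. Qed.

Lemma bump_le1 k a b x : flat_bump k a b x <= 1.
Proof.
rewrite bumpE; case: ifP => // h; rewrite -expR0 ler_expR oppr_le0 invr_ge0.
by rewrite mulr_ge0// ltW.
Qed.

Lemma bump_supp (a b x : R) : a < b -> (0 < (x - a) * (b - x)) = (a < x < b).
Proof.
move=> ab; apply/idP/idP => [h|/andP[ax xb]]; last by rewrite mulr_gt0 ?subr_gt0.
have [xa|ax] := leP x a.
  have : (x - a) * (b - x) <= 0 by rewrite mulr_le0_ge0 ?subr_le0 ?subr_ge0// (le_trans xa)// ltW.
  by rewrite leNgt h.
have [bx|xb //] := leP b x.
have : (x - a) * (b - x) <= 0 by rewrite mulr_ge0_le0 ?subr_le0 ?subr_ge0// ltW.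
by rewrite leNgt h.
Qed.

Lemma bump_cvg (a b x : R) : a < b ->
  flat_bump k a b x @[k --> \oo] --> ((a < x < b)%R%:R : R).
Proof.
move=> ab; rewrite -(bump_supp x ab); under eq_fun do rewrite bumpE.
have [h|h] := boolP (0 < (x - a) * (b - x)); last exact: cvg_cst.
rewrite -[1%:R](@expR0 R); apply: continuous_cvg; first exact: continuous_expR.
rewrite -oppr0; apply: cvgN; rewrite -[0 in X in _ --> X](mul0r ((x - a) * (b - x))^-1).
under eq_fun do rewrite invfM.
by apply: cvgM; [exact: cvg_harmonic|exact: cvg_cst].
Qed.

End smooth_real.

Section directional.
Variables (R : realType) (V W : normedModType R).

(** Reduces directional derivatives to one-variable calculus, at every point of the line and not
    only at its origin. *)
Lemma is_derive_line (f : V -> W) (x v : V) (t : R) (d : W) :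
  is_derive (x + t *: v) v f d <-> is_derive t (1 : R) (fun h : R => f (x + h *: v)) d.
Proof.
have E : (fun h => h^-1 *: (((fun h : R => f (x + h *: v)) \o shift t) (h *: (1 : R)) -
      f (x + t *: v))) =
    (fun h => h^-1 *: ((f \o shift (x + t *: v)) (h *: v) - f (x + t *: v))).
  apply/funext => h /=; congr (_ *: (f _ - _)).
  by rewrite scalerDl addrCA [h *: 1]mulr1.
split=> -[fd dd].
- by apply: DeriveDef; [rewrite /derivable E|rewrite /derive E].
- by apply: DeriveDef; [rewrite /derivable -E|rewrite /derive -E].
Qed.

Lemma is_derive_line0 (f : V -> W) (x v : V) (d : W) :
  is_derive x v f d <-> is_derive (0 : R) (1 : R) (fun h : R => f (x + h *: v)) d.
Proof. by rewrite -is_derive_line scale0r addr0. Qed.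

End directional.

(** * Products of one-variable functions and bump functions on boxes *)

Section tensor.
Variables (R : realType) (N : nat).
Implicit Types (F : 'I_N -> R -> R) (x a b : 'rV[R]_N).

Definition tensor F x : R := \prod_(i < N) F i (x 0 i).

Lemma is_derive_tensor F (F' : R -> R) j x :
  (forall t : R, is_derive t (1 : R) (F j) (F' t)) ->
  is_derive x (delta_mx 0 j) (tensor F) (tensor (fun i => if i == j then F' else F i) x).
Proof.
move=> FF'; apply/is_derive_line0.
pose c := \prod_(i < N | i != j) F i (x 0 i).
have -> : (fun h : R => tensor F (x + h *: delta_mx 0 j)) = (fun h => F j (h + x 0 j) * c).
  apply/funext => h; rewrite /tensor (bigD1 j)//= !mxE !eqxx mulr1 addrC; congr (_ * _).
  by apply: eq_bigr => i /negbTE ij; rewrite !mxE eqxx/= ij mulr0 addr0.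
have -> : tensor (fun i => if i == j then F' else F i) x = c *: F' (0 + x 0 j).
  rewrite add0r /tensor (bigD1 j)//= eqxx mulrC; congr (_ * _).
  by apply: eq_bigr => i /negbTE ->.
have d1 : is_derive (0 : R) (1 : R) (fun h => F j (h + x 0 j)) (F' (0 + x 0 j)).
  rewrite -[F' _]mulr1.
  by apply: (@is_derive1_comp R (F j) (fun h => h + x 0 j)); apply: is_derive_eq; rewrite addr0.
rewrite (_ : (fun _ => _) = c \*: (fun h => F j (h + x 0 j))); first exact: is_deriveZ.
by apply/funext => h; rewrite mulrC.
Qed.

Lemma continuous_tensor F : (forall i (t : R), derivable (F i) t 1) -> continuous (tensor F).
Proof.
move=> dF; apply: continuous_big => [|i _ x]; first exact: mul_continuous.
apply: continuous_comp; first exact: coord_continuous.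
exact/differentiable_continuous/derivable1_diffP.
Qed.

Lemma partials_tensor F s : (forall i n, n_derivable n (F i)) ->
  partials s (tensor F) = tensor (fun i => derive1n (count_mem i s) (F i)).
Proof.
move=> dF; elim: s => [|j s IH] //=; rewrite IH; apply/funext => x.
have h t : is_derive t (1 : R) (derive1n (count_mem j s) (F j))
      (derive1n (count_mem j s).+1 (F j) t).
  apply: DeriveDef; first exact: n_derivable_derive1n.
  by rewrite derive1nS derive1E.
rewrite /partial.
have [_ ->] := @is_derive_tensor (fun i => derive1n (count_mem i s) (F i)) _ j x h.
by congr tensor; apply/funext => i; rewrite eq_sym; case: eqP => [->|_]//=; rewrite add0n.
Qed.

Lemma smooth_tensor F : (forall i n, n_derivable n (F i)) -> smooth (tensor F).
Proof.
move=> dF s; rewrite partials_tensor//; split.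
  by apply: continuous_tensor => i t; exact: n_derivable_derive1n.
move=> j x; have h t : is_derive t (1 : R) (derive1n (count_mem j s) (F j))
      (derive1n (count_mem j s).+1 (F j) t).
  apply: DeriveDef; first exact: n_derivable_derive1n.
  by rewrite derive1nS derive1E.
by have [] := @is_derive_tensor (fun i => derive1n (count_mem i s) (F i)) _ j x h.
Qed.

Definition open_box (a b : 'rV[R]_N) := [set x : 'rV[R]_N | forall i, a 0 i < x 0 i < b 0 i].
Definition closed_box (a b : 'rV[R]_N) := [set x : 'rV[R]_N | forall i, a 0 i <= x 0 i <= b 0 i].

Lemma compact_closed_box a b : compact (closed_box a b).
Proof.
exact: (@rV_compact R N (fun i => [set` `[a 0 i, b 0 i]])
  (fun i => @segment_compact R (a 0 i) (b 0 i))).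
Qed.

Lemma closed_closed_box a b : closed (closed_box a b).
Proof. by apply: compact_closed; [exact: norm_hausdorff|exact: compact_closed_box]. Qed.

Lemma open_boxE a b : open_box a b =
  \bigcap_(i in [set: 'I_N]) (fun x : 'rV[R]_N => x 0 i) @^-1` `]a 0 i, b 0 i[.
Proof.
apply/seteqP; split=> x /= h i; first by move=> _ /=; rewrite in_itv/=.
by have /= := h i I; rewrite in_itv.
Qed.

Lemma measurable_open_box a b : measurable (open_box a b).
Proof.
rewrite open_boxE; apply: fin_bigcap_measurable => [|i _]; first exact: finite_finset.
rewrite -[X in measurable X]setTI.
by apply: continuous_rV_measurable => //; exact: coord_continuous.
Qed.

Definition box_bump k (a b : 'rV[R]_N) := tensor (fun i => flat_bump k (a 0 i) (b 0 i)).

Lemma box_bump_ge0 k a b x : 0 <= box_bump k a b x.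
Proof. by apply: prodr_ge0 => i _; exact: bump_ge0. Qed.

Lemma box_bump_le1 k a b x : box_bump k a b x <= 1.
Proof.
suff /andP[] : 0 <= box_bump k a b x <= 1 by [].
rewrite /box_bump /tensor; elim/big_ind : _ => [|u v /andP[u0 u1] /andP[v0 v1]|i _].
- by rewrite ler01 lexx.
- by rewrite mulr_ge0//= mulr_ile1.
- by rewrite bump_ge0 bump_le1.
Qed.

Lemma box_bump_eq0 k a b x : (forall i, a 0 i < b 0 i) ->
  ~ open_box a b x -> box_bump k a b x = 0.
Proof.
move=> ab /existsNP[i /negP xi]; apply/eqP/prodf_eq0; exists i => //.
by rewrite bumpE bump_supp// (negbTE xi).
Qed.

Lemma test_box_bump (Omega : set 'rV[R]_N) k a b : (forall i, a 0 i < b 0 i) ->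
  closed_box a b `<=` Omega -> test_function Omega (box_bump k a b).
Proof.
move=> ab abO.
have sub : closure [set x | box_bump k a b x != 0] `<=` closed_box a b.
  rewrite ((closure_id (closed_box a b)).1 (@closed_closed_box a b)).
  apply: closure_subset => x /= x0 i.
  have : open_box a b x.
    by apply: contrapT => /(box_bump_eq0 k ab) e; rewrite e eqxx in x0.
  by move=> /(_ i) /andP[/ltW -> /ltW ->].
split; last exact: subset_trans abO.
  by apply: smooth_tensor => i n; exact: n_derivable_bump.
by apply: (subclosed_compact _ (@compact_closed_box a b) sub); exact: closed_closure.
Qed.

Lemma box_bump_cvg a b x : (forall i, a 0 i < b 0 i) ->
  box_bump k a b x @[k --> \oo] --> (\1_(open_box a b) x : R).
Proof.
move=> ab.
have -> : \1_(open_box a b) x = \prod_(i < N) ((a 0 i < x 0 i < b 0 i)%R%:R : R).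
  rewrite indicE; have [h|h] := pselect (open_box a b x).
    by rewrite mem_set// big1// => i _; rewrite h.
  rewrite memNset//; move/existsNP : h => [i /negP/negbTE xi].
  by rewrite (bigD1 i)//= xi mul0r.
rewrite /box_bump /tensor; elim: index_enum => [|i r IH].
  by rewrite big_nil; under eq_fun do rewrite big_nil; exact: cvg_cst.
rewrite big_cons; under eq_fun do rewrite big_cons.
by apply: cvgM => //; exact: bump_cvg.
Qed.

End tensor.

(** * The fundamental lemma of the calculus of variations *)

Section boxes.
Variables (R : realType) (N : nat).
Implicit Types (a b x : 'rV[R]_N).

(** Rational corners make the union countable. Requiring the closed box inside [U] makes the bump
    functions of the box test functions on [U]. *)
Lemma open_bigcup_box (U : set 'rV[R]_N) : open U ->
  U = \bigcup_(p in [set p : 'rV[rat]_N * 'rV[rat]_N |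
        (forall i, p.1 0 i < p.2 0 i) /\
        closed_box (map_mx ratr p.1) (map_mx ratr p.2 : 'rV[R]_N) `<=` U])
      open_box (map_mx ratr p.1) (map_mx ratr p.2 : 'rV[R]_N).
Proof.
move=> oU; apply/seteqP; split=> [x Ux|x [p [_ pU] px]]; last first.
  by apply: pU => i; have /andP[/ltW -> /ltW ->] := px i.
have : nbhs x U by apply: open_nbhs_nbhs.
move=> /nbhs_ballP[e /= e0 xeU].
have /choice[q xq] : forall i, exists q : rat, ratr q \in `](x 0 i - e), x 0 i[.
  by move=> i; apply: rat_in_itvoo; rewrite gtrBl.
have /choice[r xr] : forall i, exists r : rat, ratr r \in `]x 0 i, (x 0 i + e)[.
  by move=> i; apply: rat_in_itvoo; rewrite ltrDl.
exists (\row_i q i, \row_i r i) => /=; last first.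
  move=> i; rewrite !mxE; have := xq i; have := xr i; rewrite !in_itv/=.
  by move=> /andP[-> _] /andP[_ ->].
split=> [i|y yq].
  rewrite !mxE -(ltr_rat R); have := xq i; have := xr i; rewrite !in_itv/=.
  by move=> /andP[h _] /andP[_ h']; exact: lt_trans h' h.
apply: xeU; split=> //= i j; rewrite !ord1 /ball/=.
have := yq j; rewrite !mxE; have := xq j; have := xr j; rewrite !in_itv/=.
move=> /andP[r1 r2] /andP[q1 q2] /andP[y1 y2].
rewrite ltr_distl; apply/andP; split.
  by rewrite ltrBlDr (le_lt_trans y2).
by rewrite -ltrBlDr (lt_le_trans q1).
Qed.

Lemma open_boxI a b c d : open_box a b `&` open_box c d =
  open_box (\row_i Num.max (a 0 i) (c 0 i)) (\row_i Num.min (b 0 i) (d 0 i)).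
Proof.
apply/seteqP; split=> x /=.
  move=> [xab xcd] i; rewrite !mxE gt_max lt_min.
  by have /andP[-> ->] := xab i; have /andP[-> ->] := xcd i.
move=> h; split=> i; have := h i; rewrite !mxE gt_max lt_min.
  by move=> /andP[/andP[-> _] /andP[-> _]].
by move=> /andP[/andP[_ ->] /andP[_ ->]].
Qed.

(** Degenerate boxes are included, which keeps the family stable under intersection: it is the
    pi-system for Dynkin's lemma. *)
Definition boxes : set (set 'rV[R]_N) := [set open_box p.1 p.2 | p in [set: 'rV[R]_N * 'rV[R]_N]].

Lemma measurable_boxesE : @measurable _ 'rV[R]_N = <<s boxes >>.
Proof.
apply/seteqP; split=> [A|A].
  apply: smallest_sub; first exact: smallest_sigma_algebra.
  move=> U oU; rewrite (open_bigcup_box oU) bigcup_mkcond.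
  apply: (@countable_bigcupT_measurable _ (g_sigma_algebraType boxes)) => [|p].
    exact: countableP.
  case: ifP => _; last exact: measurable0.
  by apply: sub_sigma_algebra; exists (map_mx ratr p.1, map_mx ratr p.2).
apply: smallest_sub; first exact: sigma_algebra_measurable.
by move=> _ [[a b] _ <-]; exact: measurable_open_box.
Qed.

Lemma setI_closed_boxes : setI_closed boxes.
Proof.
move=> _ _ [[a b] _ <-] [[c d] _ <-] /=; rewrite open_boxI.
by exists (\row_i Num.max (a 0 i) (c 0 i), \row_i Num.min (b 0 i) (d 0 i)).
Qed.

Lemma measurable_closed_box a b : measurable (closed_box a b).
Proof.
rewrite -[closed_box a b]setCK; apply: measurableC; apply: rV_open_measurable.
by apply: closed_openC; exact: closed_closed_box.
Qed.

Lemma sub_open_closed_box a b : open_box a b `<=` closed_box a b.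
Proof. by move=> x xab i; have /andP[/ltW -> /ltW ->] := xab i. Qed.

Lemma lebesgue_closed_box_fin a b : (lebesgue_rV R N (closed_box a b) < +oo)%E.
Proof.
(* Strictly below [a], so that the half-open box contains the closed one, and below [b], so that the
   volume formula applies even when [a <= b] fails. *)
pose a' := \row_i (Num.min (a 0 i) (b 0 i) - 1).
have a'b i : a' 0 i <= b 0 i.
  by rewrite mxE lerBlDr ge_min lerDl ler01 orbT.
have sub : closed_box a b `<=` [set x : 'rV[R]_N | forall i, a' 0 i < x 0 i <= b 0 i].
  move=> x xab i; have /andP[ax ->] := xab i; rewrite andbT mxE ltrBlDr.
  by rewrite gt_min (le_lt_trans ax)// ltrDl.
apply: (@le_lt_trans _ _ (lebesgue_rV R N [set x : 'rV[R]_N | forall i, a' 0 i < x 0 i <= b 0 i])).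
  apply: le_measure => //; rewrite inE; first exact: measurable_closed_box.
  rewrite (_ : mkset _ = \bigcap_(i in [set: 'I_N])
      (fun x : 'rV[R]_N => x 0 i) @^-1` `](a' 0 i), (b 0 i)]%classic).
    apply: fin_bigcap_measurable => [|i _]; first exact: finite_finset.
    rewrite -[X in measurable X]setTI.
    by apply: continuous_rV_measurable => //; exact: coord_continuous.
  apply/seteqP; split=> x /= xab i; first by move=> _ /=; rewrite in_itv/=.
  by have /= := xab i I; rewrite in_itv/=.
by rewrite lebesgue_rV_box// ltry.
Qed.

End boxes.

Section integration_on.
Variables (R : realType) (N : nat) (Omega : domain R N).
Local Notation mu := (lebesgue_on Omega).
Implicit Types (a b x : 'rV[R]_N).

Lemma lebesgue_on_le A : measurable A -> (mu A <= lebesgue_rV R N A)%E.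
Proof.
move=> mA; rewrite -[mu A]/(lebesgue_rV R N (A `&` Omega)).
apply: le_measure; rewrite ?inE//.
by apply: measurableI => //; apply: rV_open_measurable; exact: domain_open.
Qed.

Lemma lebesgue_on_closed_box_fin a b : (mu (closed_box a b) < +oo)%E.
Proof.
apply: le_lt_trans (lebesgue_closed_box_fin a b).
by apply: lebesgue_on_le; exact: measurable_closed_box.
Qed.

Lemma Lfun2_bounded_box (f : 'rV[R]_N -> R) (C : R) a b : measurable_fun setT f ->
  (forall x, `|f x| <= C) -> (forall x, ~ closed_box a b x -> f x = 0) ->
  f \in Lfun mu 2%:E.
Proof.
move=> mf fC fab; apply: Lfun2_sqr_fin => //.
apply: (@le_lt_trans _ _ (\int[mu]_x ((C ^+ 2)%R%:E * (\1_(closed_box a b) x)%R%:E))%E).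
  apply: ge0_le_integral => //.
  - by move=> x _; rewrite lee_fin sqr_ge0.
  - by apply/measurable_EFinP; exact: measurable_funX.
  - apply: emeasurable_funM => //; apply/measurable_EFinP.
    by apply: measurable_indic; exact: measurable_closed_box.
  - move=> x _; rewrite -EFinM lee_fin indicE.
    have [h|h] := pselect (closed_box a b x).
      rewrite mem_set// mulr1 -(real_normK (num_real (f x))).
      by rewrite ler_pXn2r ?nnegrE// (le_trans _ (fC x)).
    by rewrite fab// memNset// mulr0 expr0n.
rewrite ge0_integralZl//; last 2 first.
  by apply/measurable_EFinP; apply: measurable_indic; exact: measurable_closed_box.
  by rewrite lee_fin sqr_ge0.
rewrite integral_indic//; last exact: measurable_closed_box.
rewrite setIT lte_mul_pinfty ?lee_fin ?sqr_ge0//; exact: lebesgue_on_closed_box_fin.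
Qed.

End integration_on.

Section fundamental_lemma.
Variables (R : realType) (N : nat) (Omega : domain R N).
Local Notation mu := (lebesgue_on Omega).
Variable u : L2 Omega.
Hypothesis u0 : forall phi, test_function Omega phi -> \int[mu]_x (u x * phi x) = 0.
Implicit Types (a b x : 'rV[R]_N).

Let integrable_box a b : mu.-integrable (open_box a b) (EFin \o u).
Proof.
have h : (\1_(open_box a b) : 'rV[R]_N -> R) \in Lfun mu 2%:E.
  apply: (@Lfun2_bounded_box _ _ _ _ 1 a b).
  - by apply: measurable_indic; exact: measurable_open_box.
  - by move=> x; rewrite indicE; case: (_ \in _); rewrite ?normr1 ?normr0.
  - by move=> x h; rewrite indicE memNset// => /sub_open_closed_box.
rewrite integrable_mkcond; last exact: measurable_open_box.
have := (Lfun1_integrable _ _).1 (Lfun2_mul_Lfun1 (L2P u) h).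
congr integrable; apply/funext => x; rewrite /= patchE indicE.
by case: ifP => _; rewrite ?mulr1 ?mulr0.
Qed.

(** Dominated convergence along the bump functions of the box, which stay between 0 and 1, with
    majorant [|u|]. *)
Let integral_box a b : (forall i, a 0 i < b 0 i) -> closed_box a b `<=` Omega ->
  (\int[mu]_(x in open_box a b) (u x)%:E = 0)%E.
Proof.
move=> ab abO; have mab := measurable_open_box a b.
have bm k : measurable_fun setT (box_bump k a b).
  apply: continuous_rV_measurable; have [sm _ _] := test_box_bump k ab abO.
  by have [] := sm [::].
have [] := @dominated_convergence _ _ _ mu (open_box a b) mab
  (fun k x => (u x * box_bump k a b x)%:E) (EFin \o u) (fun x => `|u x|%:E).
- move=> k; apply/measurable_EFinP; apply: measurable_funS measurableT _ _ => //.
  by apply: measurable_funM => //; exact: measurable_L2fun.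
- by apply/measurable_EFinP; apply: measurable_funS measurableT _ _ => //; exact: measurable_L2fun.
- apply: aeW => x xab; apply: cvg_EFin; first exact: nearW.
  rewrite -[X in _ --> X]mulr1; apply: cvgM; first exact: cvg_cst.
  by have := box_bump_cvg (x := x) ab; rewrite indicE mem_set.
- by have := integrable_abse (integrable_box a b).
- apply: aeW => x k xab; rewrite lee_fin normrM (ger0_norm (box_bump_ge0 _ _ _ _)).
  by rewrite ler_piMr// box_bump_le1.
move=> _ _ h; apply: cvg_unique h _ => //.
rewrite (_ : (fun _ => _) = fun=> 0%E); first exact: cvg_cst.
apply/funext => k /=.
have tk := test_box_bump k ab abO.
have : (\int[mu]_x (u x * box_bump k a b x)%:E = 0)%E.
  rewrite -[RHS]/(0%R%:E) -(u0 tk) /Rintegral fineK//; apply: integrable_fin_num => //.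
  apply/Lfun1_integrable; apply: Lfun2_mul_Lfun1; first exact: L2P.
  apply: (@Lfun2_bounded_box _ _ _ _ 1 a b) => // x.
    by rewrite ger0_norm ?box_bump_ge0 ?box_bump_le1.
  by move=> xab; apply: box_bump_eq0 => // /sub_open_closed_box.
move=> <-; rewrite integral_mkcond; apply: eq_integral => x _.
rewrite patchE; case: ifPn => // /negP; rewrite inE => xab.
by rewrite box_bump_eq0// mulr0.
Qed.

Let ae0_box a b : (forall i, a 0 i < b 0 i) -> closed_box a b `<=` Omega ->
  ae_eq mu (open_box a b) (EFin \o u) (cst 0%E).
Proof.
move=> ab abO; have mab := measurable_open_box a b.
apply: integral_ae_eq => // E Eab mE.
rewrite integral_cst// mul0e.
(* The sets on which the integral vanishes form a Dynkin system; [PT] provides the whole space,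
   needed for complements. *)
pose P (A : set 'rV[R]_N) := (\int[mu]_(x in open_box a b `&` A) (u x)%:E = 0)%E.
suff PA : forall A, measurable A -> P A.
  by have := PA _ mE; rewrite /P (setIidr Eab).
have iS A : measurable A -> mu.-integrable (open_box a b `&` A) (EFin \o u).
  by move=> mA; apply: integrableS (integrable_box a b) => //; exact: measurableI.
have PT : P setT by rewrite /P setIT; exact: integral_box.
move=> A; rewrite measurable_boxesE.
apply: (dynkin_induction (@measurable_boxesE R N) (@setI_closed_boxes R N)) => //.
- move=> _ [[c d] _ <-]; rewrite /P/= open_boxI.
  set a' := \row_i _; set b' := \row_i _.
  (* The intersection of two boxes is either a nondegenerate box, still inside [Omega], or empty. *)
  have [a'b'|/existsNP[i a'b']] := pselect (forall i, a' 0 i < b' 0 i).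
    apply: integral_box => // x xab; apply: abO => i; have := xab i.
    rewrite !mxE ge_max le_min.
    by move=> /andP[/andP[-> _] /andP[-> _]].
  rewrite (_ : open_box a' b' = set0) ?integral_set0//.
  apply/seteqP; split=> // x /(_ i) /andP[h1 h2].
  by apply: a'b'; exact: lt_trans h1 h2.
- move=> S mS; rewrite /P => PS; move: PT; rewrite /P -(setUv S) setIUr.
  rewrite integral_setU//; last 4 first.
  + exact: measurableI.
  + by apply: measurableI => //; exact: measurableC.
  + rewrite -setIUr setUv setIT; exact: measurable_int (integrable_box a b).
  + by apply/disj_setPLR => x [_ Sx] [_ /(_ Sx)].
  by rewrite PS add0e.
- move=> F mF tF PF; rewrite /P setI_bigcupr integral_bigcup.
  + by apply: eseries0 => k _ _; exact: PF.
  + exact: trivIset_setIl.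
  + by move=> k; exact: measurableI.
  + rewrite -setI_bigcupr; apply: iS; exact: bigcup_measurable.
Qed.

(** The complement of [Omega] is null for [lebesgue_on], and [Omega] is a countable union of boxes
    on each of which [u] vanishes almost everywhere. *)
Lemma L2_test_orth_eq0 : u = 0.
Proof.
apply: L2_eqP; apply: ae_eq_trans _ (ae_eq_sym (zeroL2E mu)).
suff : mu.-negligible [set x | u x != 0].
  by apply: negligibleS => x /= h; apply/negP => /eqP ux; apply: h => _.
pose bx (p : 'rV[rat]_N * 'rV[rat]_N) : set 'rV[R]_N :=
  open_box (map_mx ratr p.1) (map_mx ratr p.2).
pose D := [set p : 'rV[rat]_N * 'rV[rat]_N | (forall i, p.1 0 i < p.2 0 i) /\
        closed_box (map_mx ratr p.1) (map_mx ratr p.2 : 'rV[R]_N) `<=` Omega].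
apply: (@negligibleS _ _ _ _ (~` Omega `|` \bigcup_(p in D) (bx p `&` [set x | u x != 0]))).
  move=> x ux; have [Ox|] := pselect ((Omega : set _) x); last by left.
  right; move: Ox; rewrite {1}(open_bigcup_box (@domain_open _ _ Omega)) => -[p Dp px].
  by exists p.
apply: negligibleU.
  exists (~` Omega); split => //.
    by apply: measurableC; apply: rV_open_measurable; exact: domain_open.
  by rewrite -[LHS]/(lebesgue_rV R N (~` Omega `&` Omega)) setICl measure0.
rewrite bigcup_mkcond.
pose G (p : 'rV[rat]_N * 'rV[rat]_N) := if p \in D then bx p `&` [set x | u x != 0] else set0.
apply: (@negligibleS _ _ _ _ (\bigcup_n (if unpickle n is Some p then G p else set0))).
  by move=> x [p _ Gpx]; exists (pickle p) => //; rewrite pickleK.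
apply: negligible_bigcup => n; case: (unpickle n) => [p|]; last exact: negligible_set0.
rewrite /G; case: ifPn => [/set_mem[pD1 pD2]|_]; last exact: negligible_set0.
have pD i : (map_mx ratr p.1 : 'rV[R]_N) 0 i < (map_mx ratr p.2 : 'rV[R]_N) 0 i.
  by rewrite !mxE ltr_rat.
have := @ae0_box (map_mx ratr p.1) (map_mx ratr p.2) pD pD2.
apply: negligibleS => x [px /eqP ux] /= h.
exact: ux (EFin_inj (h px)).
Qed.

End fundamental_lemma.

(** * Integration by parts *)

Section box_support.
Variables (R : realType) (N : nat).
Implicit Types (f g : 'rV[R]_N -> R) (M : R) (x : 'rV[R]_N).

Definition box_supported M f := forall x, ~ closed_box (const_mx (- M)) (const_mx M) x -> f x = 0.

Lemma continuous_box_bounded M f : continuous f -> box_supported M f ->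
  exists C : R, forall x, `|f x| <= C.
Proof.
move=> cf sf.
have /compact_bounded : compact (f @` closed_box (const_mx (- M)) (const_mx M)).
  by apply: continuous_compact; [exact: continuous_subspaceT|exact: compact_closed_box].
move=> [C [_ /(_ (`|C| + 1)) /= h]].
exists (`|C| + 1) => x.
have [xM|xM] := pselect (closed_box (const_mx (- M)) (const_mx M) x); last first.
  by rewrite sf// normr0 addr_ge0.
apply: h; last by exists x.
by rewrite (le_lt_trans (ler_norm C))// ltrDl.
Qed.

Lemma integrable_box_supported M f : continuous f -> box_supported M f ->
  (lebesgue_rV R N).-integrable setT (EFin \o f).
Proof.
move=> cf sf; have [C fC] := continuous_box_bounded cf sf.
have mf := continuous_rV_measurable cf.
have mK := measurable_closed_box (const_mx (- M) : 'rV[R]_N) (const_mx M).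
have C0 : 0 <= C by apply: le_trans (fC 0).
apply/integrableP; split; first exact/measurable_EFinP.
apply: (@le_lt_trans _ _ (\int[lebesgue_rV R N]_x
    (C%:E * (\1_(closed_box (const_mx (- M)) (const_mx M)) x)%R%:E))%E).
  apply: ge0_le_integral => //.
  - by apply: measurableT_comp => //; exact/measurable_EFinP.
  - by apply: emeasurable_funM => //; apply/measurable_EFinP; exact: measurable_indic.
  - move=> x _; rewrite -EFinM lee_fin indicE.
    have [h|h] := pselect (closed_box (const_mx (- M)) (const_mx M) x).
      by rewrite mem_set// mulr1.
    by rewrite sf// memNset// mulr0 normr0.
rewrite ge0_integralZl//; last by apply/measurable_EFinP; exact: measurable_indic.
rewrite integral_indic// setIT lte_mul_pinfty ?lee_fin//; exact: lebesgue_closed_box_fin.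
Qed.

Lemma box_supported_partial M i f : box_supported M f -> box_supported M (partial i f).
Proof.
move=> sf x xM; rewrite /partial.
rewrite (near_eq_derive (g := cst 0)) ?derive_cst//.
have : nbhs x (~` closed_box (const_mx (- M)) (const_mx M)).
  by apply: open_nbhs_nbhs; split=> //; apply: closed_openC; exact: closed_closed_box.
by apply: filterS => y; exact: sf.
Qed.

End box_support.

(** * The integral of a partial derivative of a compactly supported function vanishes *)

Section divergence.
Variable R : realType.

(** Both orders of integration are needed: which one is used depends on whether the first coordinate
    is the differentiated one. *)
Lemma integral_lebesgue_rVS N (G : 'rV[R]_N.+1 -> \bar R) :
  (lebesgue_rV R N.+1).-integrable setT G ->
  (\int[lebesgue_rV R N.+1]_z G z =
     \int[@lebesgue_measure R]_t \int[lebesgue_rV R N]_y G (rV_cons (t, y)))%E /\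
  (\int[lebesgue_rV R N.+1]_z G z =
     \int[lebesgue_rV R N]_y \int[@lebesgue_measure R]_t G (rV_cons (t, y)))%E.
Proof.
move=> /integrableP[mG iG].
have iGc : ((@lebesgue_measure R) \x (lebesgue_rV R N))%E.-integrable setT (G \o @rV_cons R N).
  apply/integrableP; split; first exact: (measurableT_comp mG (@measurable_rV_cons R N)).
  move: iG; rewrite ge0_integral_pushforward//.
  exact: measurableT_comp.
have -> : (\int[lebesgue_rV R N.+1]_z G z =
    \int[(@lebesgue_measure R) \x (lebesgue_rV R N)]_z (G \o @rV_cons R N) z)%E.
  by rewrite integral_pushforward.
by split; [rewrite -integral12_prod_meas1|rewrite -integral21_prod_meas1].
Qed.

Lemma rV_cons_lineE N (t : R) (y : 'rV[R]_N) :
  rV_cons (t, y) = rV_cons (0, y) + t *: delta_mx 0 ord0.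
Proof.
apply/rowP => i; rewrite [RHS]mxE [X in _ + X]mxE [delta_mx _ _ _ _]mxE.
case: (@split_ordP 1 N i) => j ->.
  rewrite !rV_consl/= add0r (ord1 j).
  by rewrite (_ : lshift N 0 = ord0) ?eqxx ?mulr1//; exact/val_inj.
by rewrite !rV_consr/= mulr0 addr0.
Qed.

Lemma rV_consD N (t h : R) (y : 'rV[R]_N) (j : 'I_N) :
  rV_cons (t, y + h *: delta_mx 0 j) = rV_cons (t, y) + h *: delta_mx 0 (lift ord0 j).
Proof.
apply/rowP => i; rewrite [RHS]mxE [(_ *: delta_mx _ _) _ _]mxE [delta_mx _ _ _ _]mxE -rshift1.
case: (@split_ordP 1 N i) => k ->; last first.
  by rewrite !rV_consr/= !mxE -!val_eqE.
by rewrite !rV_consl/= (ord1 k) -!val_eqE/= mulr0 addr0.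
Qed.

Lemma continuous_rV_cons N (t : R) : continuous (fun y : 'rV[R]_N => rV_cons (t, y)).
Proof.
move=> y B /nbhs_ballP[e e0 eB]; apply/nbhs_ballP; exists e => // z yz; apply: eB.
split=> // i j; case: (@split_ordP 1 N j) => k ->; rewrite !(ord1 i).
  by rewrite !rV_consl; exact: ballxx.
by rewrite !rV_consr; exact: yz.2.
Qed.

Lemma integral_derive1_eq0 (g dg : R -> R) (M : R) : (forall t : R, is_derive t (1 : R) g (dg t)) ->
  continuous dg -> (forall t, M < `|t| -> g t = 0) ->
  (\int[@lebesgue_measure R]_t (dg t)%:E = 0)%E.
Proof.
move=> gdg cdg gM.
(* Positive and strictly beyond [M], so [g] vanishes at both endpoints and [dg] vanishes outside
   [[-A, A]]. *)
pose A : R := `|M| + 1.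
have MA : M < A by rewrite (le_lt_trans (ler_norm M))// ltrDl.
have A0 : 0 < A by rewrite ltr_wpDl.
have dg0 t : A < `|t| -> dg t = 0.
  move=> At; have dd := gdg t; rewrite -(@derive_val _ _ _ _ _ _ _ dd).
  rewrite (near_eq_derive (g := cst 0)) ?derive_cst//.
  have /filterS : nbhs t [set u : R | A < `|u|].
    exact: (@norm_continuous R R t _ (lt_nbhsr At)).
  by apply => u /= Au; apply: gM; exact: lt_trans Au.
have -> : (\int[@lebesgue_measure R]_t (dg t)%:E =
    \int[@lebesgue_measure R]_(t in `[(- A)%R, A]) (dg t)%:E)%E.
  rewrite [RHS]integral_mkcond; apply: eq_integral => t _; rewrite patchE.
  case: ifPn => // /negP; rewrite inE/= in_itv/= -ler_norml => /negP.
  by rewrite -ltNge => /dg0 ->.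
have cg : continuous g.
  by move=> t; apply/differentiable_continuous/derivable1_diffP; have [] := gdg t.
rewrite (@continuous_FTC2 _ dg g).
- by rewrite !gM ?subee// ?normrN gtr0_norm.
- by rewrite gtrN.
- exact: continuous_subspaceT.
- split; first by move=> t _; have [] := gdg t.
  + by apply: cvg_at_right_filter; exact: cg.
  + by apply: cvg_at_left_filter; exact: cg.
- by move=> t _; rewrite derive1E; have [_] := gdg t.
Qed.

Lemma integral_partial_eq0 N (f : 'rV[R]_N -> R) (i : 'I_N) (M : R) :
  continuous f -> (forall x, derivable f x (delta_mx 0 i)) ->
  continuous (partial i f) -> box_supported M f ->
  (\int[lebesgue_rV R N]_x (partial i f x)%:E = 0)%E.
Proof.
elim: N f i => [|N IH] f i; first by case: i.
move=> cf df cpf sf.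
have [e1 e2] := integral_lebesgue_rVS (integrable_box_supported cpf (box_supported_partial _ sf)).
have outl (t : R) (y : 'rV[R]_N) : M < `|t| -> f (rV_cons (t, y)) = 0.
  move=> Mt; apply: sf => /(_ (lshift N (ord0 : 'I_1))); rewrite rV_consl !mxE/=.
  by rewrite -ler_norml leNgt Mt.
(* If the differentiated coordinate is not the first, each slice with fixed first coordinate falls
   under the induction hypothesis. Otherwise the first coordinate is integrated innermost by the
   fundamental theorem of calculus. *)
case: (@unliftP _ ord0 i) => [j ij|i0].
- rewrite e1 -[RHS](integral0 (@lebesgue_measure R) setT).
  apply: eq_integral => t _.
  have dfj (y : 'rV[R]_N) : is_derive y (delta_mx 0 j) (fun y => f (rV_cons (t, y)))
      (partial i f (rV_cons (t, y))).
    apply: (is_derive_line0 (fun y => f (rV_cons (t, y))) _ _ _).2.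
    have -> : (fun h : R => f (rV_cons (t, y + h *: delta_mx 0 j))) =
        (fun h : R => f (rV_cons (t, y) + h *: delta_mx 0 i)).
      by apply/funext => h; rewrite rV_consD ij.
    by apply: (is_derive_line0 f _ _ _).1; exact: DeriveDef.
  rewrite -[RHS](IH (fun y => f (rV_cons (t, y))) j).
  + by apply: eq_integral => y _; rewrite /partial; have [_ ->] := dfj y.
  + by move=> y; apply: continuous_comp; [exact: continuous_rV_cons|exact: cf].
  + by move=> y; have [] := dfj y.
  + rewrite (_ : partial _ _ = fun y => partial i f (rV_cons (t, y))).
      by move=> y; apply: continuous_comp; [exact: continuous_rV_cons|exact: cpf].
    by apply/funext => y; rewrite /partial; have [_ ->] := dfj y.
  + move=> y yM; apply: sf => h; apply: yM => k; have := h (rshift 1 k).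
    by rewrite rV_consr !mxE.
- rewrite e2 -[RHS](integral0 (lebesgue_rV R N) setT).
  apply: eq_integral => y _.
  apply: (@integral_derive1_eq0 (fun t => f (rV_cons (t, y))) _ M).
  + move=> t; have -> : (fun t => f (rV_cons (t, y))) =
        (fun h : R => f (rV_cons (0, y) + h *: delta_mx 0 i)).
      by apply/funext => h; rewrite rV_cons_lineE i0.
    by rewrite (rV_cons_lineE t y) -i0; apply: (is_derive_line f _ _ _ _).1; exact: DeriveDef.
  + move=> t; apply: continuous_comp; last exact: cpf.
    have -> : (fun t => rV_cons (t, y)) = (fun h : R => rV_cons (0, y) + h *: delta_mx 0 ord0).
      by apply/funext => h; rewrite -rV_cons_lineE.
    by apply: cvgD; [exact: cvg_cst|apply: cvgZr_tmp].
  + by move=> t; exact: outl.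
Qed.

End divergence.

(** * Symmetry of mixed second derivatives *)

Section schwarz.
Variables (R : realType) (V : normedModType R).
Implicit Types (f : V -> R) (v w x : V).

Lemma line_MVT f v x (d : R) : 0 < d -> (forall y, derivable f y v) ->
  exists2 s : R, 0 < s < d & f (x + d *: v) - f x = 'D_v f (x + s *: v) * d.
Proof.
move=> d0 df.
pose g t := f (x + t *: v).
have dg (t : R) : is_derive t (1 : R) g ('D_v f (x + t *: v)).
  by apply: (is_derive_line f _ _ _ _).1; exact: DeriveDef.
have cg : {within `[0, d], continuous g}.
  by apply: derivable_within_continuous => t _; have [] := dg t.
have [s sd] := @MVT R g (fun t => 'D_v f (x + t *: v)) 0 d d0 (fun t _ => dg t) cg.
rewrite /g scale0r addr0 subr0 => e.
by exists s; [move: sd; rewrite in_itv|].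
Qed.

(* The left-hand side is symmetric in [v] and [w]. *)
Lemma mixed_MVT f v w x (d : R) : 0 < d -> (forall y, derivable f y v) ->
  (forall y, derivable ('D_v f) y w) ->
  exists s t, [/\ 0 < s < d, 0 < t < d &
    f (x + d *: v + d *: w) - f (x + d *: v) - f (x + d *: w) + f x =
    'D_w ('D_v f) (x + s *: v + t *: w) * d ^+ 2].
Proof.
move=> d0 df ddf.
pose h y := f (y + d *: w) - f y.
have dh y : is_derive y v h ('D_v f (y + d *: w) - 'D_v f y).
  apply: is_deriveB; last exact: DeriveDef.
  apply: (is_derive_line0 _ _ _ _).2.
  have := (is_derive_line0 f (y + d *: w) v _).1 (DeriveDef (df _) erefl).
  by under eq_fun do rewrite addrAC.
have [s sd hs] := @line_MVT h v x d d0 (fun y => @ex_derive _ _ _ _ _ _ _ (dh y)).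
have [t td ts] := @line_MVT ('D_v f) w (x + s *: v) d d0 ddf.
exists s, t; split=> //; move: hs; rewrite (@derive_val _ _ _ _ _ _ _ (dh _)) ts.
by rewrite expr2 mulrA => <-; rewrite /h (addrAC x); ring.
Qed.

Lemma eq_of_near_eq (g1 g2 : V -> R) x :
  {for x, continuous g1} -> {for x, continuous g2} ->
  (forall d : R, 0 < d -> exists y z, [/\ `|x - y| < d, `|x - z| < d & g1 y = g2 z]) ->
  g1 x = g2 x.
Proof.
move=> c1 c2 near.
apply/eqP; rewrite -subr_eq0 -normr_le0; apply/ler_addgt0Pr => e e0; rewrite add0r.
have e2 : 0 < e / 2 by rewrite divr_gt0.
have /nbhs_normP[d1 /= d10 h1] : \forall y \near x, `|g1 x - g1 y| < e / 2.
  by move/cvgrPdist_lt : c1; apply.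
have /nbhs_normP[d2 /= d20 h2] : \forall y \near x, `|g2 x - g2 y| < e / 2.
  by move/cvgrPdist_lt : c2; apply.
have d0 : 0 < Num.min d1 d2 by rewrite lt_min d10.
have [y [z [xy xz yz]]] := near _ d0.
have k1 : `|g1 x - g1 y| < e / 2 by apply: h1; rewrite /= (lt_le_trans xy)// ge_min lexx.
have k2 : `|g2 x - g2 z| < e / 2 by apply: h2; rewrite /= (lt_le_trans xz)// ge_min lexx orbT.
rewrite -yz distrC in k2.
by rewrite (splitr e) (le_trans _ (ltW (ltrD k1 k2)))//; exact: ler_distD.
Qed.

(** Two applications of the mean value theorem express the same second difference through either
    mixed derivative. The two therefore agree at points arbitrarily close to [x], and by continuity
    at [x]. *)
Lemma derive_comm f v w x : (forall y, derivable f y v) -> (forall y, derivable f y w) ->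
  (forall y, derivable ('D_v f) y w) -> (forall y, derivable ('D_w f) y v) ->
  {for x, continuous ('D_w ('D_v f))} -> {for x, continuous ('D_v ('D_w f))} ->
  'D_w ('D_v f) x = 'D_v ('D_w f) x.
Proof.
move=> dv dw dvw dwv c1 c2.
apply: (eq_of_near_eq c1 c2) => e e0.
have C0 : 0 < `|v| + `|w| + 1 by rewrite ltr_wpDl ?addr_ge0.
have [d d0 dE] : exists2 d, 0 < d & forall s t, 0 < s < d -> 0 < t < d ->
    `|s *: v + t *: w| < e.
  exists (e / (`|v| + `|w| + 1)); first exact: divr_gt0.
  move=> s t /andP[s0 sd] /andP[t0 td].
  apply: (@le_lt_trans _ _ (e / (`|v| + `|w| + 1) * (`|v| + `|w|))).
    rewrite (le_trans (ler_normD _ _))// !normrZ !gtr0_norm// mulrDr.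
    by rewrite lerD// ler_wpM2r// ltW.
  by rewrite mulrAC ltr_pdivrMr// ltr_pM2l// ltrDl.
have [s [t [sd td est]]] := @mixed_MVT f v w x d d0 dv dvw.
have [s' [t' [sd' td' est']]] := @mixed_MVT f w v x d d0 dw dwv.
exists (x + s *: v + t *: w), (x + s' *: w + t' *: v); split.
- by rewrite -addrA opprD addrA subrr sub0r normrN; exact: dE.
- by rewrite -addrA opprD addrA subrr sub0r normrN addrC; exact: dE.
- have d2n : d ^+ 2 != 0 by rewrite expf_neq0// gt_eqF.
  move: est est'; rewrite (addrAC x (d *: w)).
  move: ('D_w _ _) ('D_v _ _) => p q; move: (f _) (f _) (f _) (f _) => a b a' b' e1 e2.
  by apply: (mulIf d2n); rewrite -e1 -e2; ring.
Qed.

End schwarz.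

(** * Stability of test functions under differentiation and linear combination *)

Section test_functions.
Variables (R : realType) (N : nat).
Implicit Types (phi psi : 'rV[R]_N -> R) (Omega : set 'rV[R]_N).

Lemma partialC phi i j : smooth phi -> partial i (partial j phi) = partial j (partial i phi).
Proof.
move=> sm; apply/funext => x; apply: derive_comm.
- by move=> y; have [_] := sm [::]; apply.
- by move=> y; have [_] := sm [::]; apply.
- by move=> y; have [_] := sm [:: j]; apply.
- by move=> y; have [_] := sm [:: i]; apply.
- by have [+ _] := sm [:: i; j]; apply.
- by have [+ _] := sm [:: j; i]; apply.
Qed.

Lemma smooth_partial i phi : smooth phi -> smooth (partial i phi).
Proof.
move=> sm s; have := sm (rcons s i).
by rewrite /partials foldr_rcons.
Qed.

Lemma support_partial i phi :
  closure [set x | partial i phi x != 0] `<=` closure [set x | phi x != 0].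
Proof.
rewrite [X in _ `<=` X](closure_id _).1; last exact: closed_closure.
apply: closure_subset => x /= px; apply: contrapT => nx; move/eqP: px; apply.
rewrite /partial (near_eq_derive (g := cst 0)) ?derive_cst//.
have : nbhs x (~` closure [set x | phi x != 0]).
  by apply: open_nbhs_nbhs; split=> //; apply: closed_openC; exact: closed_closure.
apply: filterS => y ny; apply: contrapT => /eqP py.
by apply: ny; exact: subset_closure.
Qed.

Lemma test_partial Omega i phi : test_function Omega phi -> test_function Omega (partial i phi).
Proof.
move=> [sm cs sO]; have sp := @support_partial i phi; split.
- exact: smooth_partial.
- by apply: subclosed_compact cs sp; exact: closed_closure.
- exact: subset_trans sp sO.
Qed.

Lemma test_partials Omega s phi : test_function Omega phi -> test_function Omega (partials s phi).
Proof. by move=> t; elim: s => //= i s; exact: test_partial. Qed.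

Lemma partials_lin s (a : R) phi psi : smooth phi -> smooth psi ->
  partials s (fun x => a * phi x + psi x) = fun x => a * partials s phi x + partials s psi x.
Proof.
move=> sp sq; elim: s => //= i s ->; apply/funext => x.
rewrite /partial.
have [_ d1] := sp s; have [_ d2] := sq s.
have e1 : is_derive x (delta_mx 0 i) (a \*: (partials s phi))
    (a *: 'D_(delta_mx 0 i) (partials s phi) x).
  by apply: is_deriveZ; exact: DeriveDef.
by have [_ ->] := is_deriveD e1 (DeriveDef (d2 i x) erefl).
Qed.

Lemma test_lin Omega (a : R) phi psi : test_function Omega phi -> test_function Omega psi ->
  test_function Omega (fun x => a * phi x + psi x).
Proof.
move=> [s1 c1 O1] [s2 c2 O2].
have sub : closure [set x | a * phi x + psi x != 0] `<=`
    closure [set x | phi x != 0] `|` closure [set x | psi x != 0].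
  rewrite -closureU; apply: closure_subset => x /=.
  have [-> /=|px _] := eqVneq (phi x) 0; last by left.
  by rewrite mulr0 add0r; right.
split.
- move=> s; rewrite partials_lin//; have [k1 d1] := s1 s; have [k2 d2] := s2 s; split.
    move=> x; apply: (@continuousD _ _ _ (fun x => a * partials s phi x)); last exact: k2.
    by apply: (@continuousM _ _ (cst a)); [exact: cst_continuous|exact: k1].
  by move=> i x; apply: derivableD; [apply: derivableZ|].
- apply: subclosed_compact _ (compactU c1 c2) sub; exact: closed_closure.
- by apply: subset_trans sub _ => x [/O1|/O2].
Qed.

Lemma test_cst0 Omega : test_function Omega (cst 0 : 'rV[R]_N -> R).
Proof.
have e : closure [set x : 'rV[R]_N | (cst 0 x : R) != 0] = set0.
  by rewrite (_ : mkset _ = set0) ?closure0//; apply/seteqP; split=> x //=; rewrite eqxx.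
split; rewrite ?e//; last exact: compact0.
move=> s; have -> : partials s (cst 0) = cst 0 :> ('rV[R]_N -> R).
  by elim: s => //= i s ->; apply/funext => x; exact: derive_cst.
by split=> [|i x]; [exact: cst_continuous|exact: derivable_cst].
Qed.

Lemma test_continuous Omega phi : test_function Omega phi -> continuous phi.
Proof. by move=> [/(_ [::])[]]. Qed.

Lemma test_derivable Omega phi i x : test_function Omega phi -> derivable phi x (delta_mx 0 i).
Proof. by move=> [/(_ [::])[_ +] _ _]; apply. Qed.

Lemma test_box_supported Omega phi : test_function Omega phi -> exists M, box_supported M phi.
Proof.
move=> [_ /compact_bounded[M [_ /(_ (`|M| + 1)) h]] _].
exists (`|M| + 1) => x xM; apply: contrapT => /eqP px; apply: xM => i.
rewrite !mxE -ler_norml.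
have xn : `|x| <= `|M| + 1.
  apply: h; last exact: subset_closure.
  by rewrite (le_lt_trans (ler_norm M))// ltrDl.
apply: le_trans xn.
by rewrite [leRHS]/Num.norm /= mx_normrE; apply/bigmax_geP; right => /=; exists (0, i).
Qed.

Lemma test_outside Omega phi x : test_function Omega phi -> ~ Omega x -> phi x = 0.
Proof.
by move=> [_ _ sO] nO; apply: contrapT => /eqP px; apply: nO; apply: sO; exact: subset_closure.
Qed.

End test_functions.

Section integration_by_parts.
Variables (R : realType) (N : nat) (Omega : domain R N).
Local Notation mu := (lebesgue_on Omega).
Implicit Types (phi psi : 'rV[R]_N -> R).

Lemma test_Lfun2 phi : test_function Omega phi -> phi \in Lfun mu 2%:E.
Proof.
move=> t; have [M sM] := test_box_supported t.
have ct := test_continuous t; have [C tC] := continuous_box_bounded ct sM.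
exact: (@Lfun2_bounded_box _ _ Omega phi C _ _ (continuous_rV_measurable ct) tC sM).
Qed.

(** Extension by zero moves integrals over [Omega] to the whole space, where Fubini can be applied
    coordinate by coordinate. *)
Lemma integral_lebesgue_on (F : 'rV[R]_N -> R) : (forall x, ~ (Omega : set _) x -> F x = 0) ->
  (\int[mu]_x (F x)%:E = \int[lebesgue_rV R N]_x (F x)%:E)%E.
Proof.
move=> FO.
have E : (fun x => (F x)%:E) = ((fun x => (F x)%:E) \_ (Omega : set _)).
  apply/funext => x; rewrite patchE; case: ifPn => // /negP; rewrite inE => /FO ->//.
rewrite E -[LHS]integral_mkcond -[RHS]integral_mkcond.
apply: eq_measure_integral => A mA AO.
by rewrite -[LHS]/(lebesgue_rV R N (A `&` Omega)) (setIidl AO).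
Qed.

Lemma test_parts i phi psi : test_function Omega phi -> test_function Omega psi ->
  \int[mu]_x (partial i phi x * psi x) = - \int[mu]_x (phi x * partial i psi x).
Proof.
move=> tp tq; have tp' := test_partial i tp; have tq' := test_partial i tq.
have dpq x : is_derive x (delta_mx 0 i) (phi * psi)
    (phi x * partial i psi x + psi x * partial i phi x).
  by apply: is_deriveM; apply: DeriveDef => //; [exact: test_derivable tp|exact: test_derivable tq].
have pE : partial i (phi * psi) = fun x => phi x * partial i psi x + psi x * partial i phi x.
  by apply/funext => x; have [_] := dpq x.
have iM f g : test_function Omega f -> test_function Omega g ->
    mu.-integrable setT (EFin \o (fun x => f x * g x)).
  move=> tf tg; apply/Lfun1_integrable.
  exact: (Lfun2_mul_Lfun1 (test_Lfun2 tf) (test_Lfun2 tg)).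
have cM (f g : 'rV[R]_N -> R) : continuous f -> continuous g -> continuous (f * g).
  by move=> cf cg x; apply: continuousM; [exact: cf|exact: cg].
have [M sM] := test_box_supported tp.
have : (\int[lebesgue_rV R N]_x (partial i (phi * psi) x)%:E = 0)%E.
  apply: (@integral_partial_eq0 _ _ _ _ M).
  - by apply: cM; [exact: test_continuous tp|exact: test_continuous tq].
  - by move=> x; have [] := dpq x.
  - rewrite pE => x; apply: (@continuousD _ _ _ (phi * partial i psi) (psi * partial i phi)).
      by apply: cM; [exact: test_continuous tp|exact: test_continuous tq'].
    by apply: cM; [exact: test_continuous tq|exact: test_continuous tp'].
  - by move=> x xM; have -> : (phi * psi) x = phi x * psi x by []; rewrite (sM x xM) mul0r.
rewrite -integral_lebesgue_on => [i0|x xO]; last first.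
  by rewrite pE (test_outside tp xO) (test_outside tq xO) !mul0r addr0.
have : \int[mu]_x (partial i (phi * psi) x) = 0 by rewrite /Rintegral i0.
rewrite pE RintegralD//; [|exact: iM|exact: iM].
move=> /eqP; rewrite addrC addr_eq0 => /eqP <-.
by congr Rintegral; apply/funext => x; rewrite mulrC.
Qed.

End integration_by_parts.

(** * Weak derivatives and Sobolev spaces *)

Section L2_dot_theory.
Context d (T : measurableType d) (R : realType).
Variable mu : {measure set T -> \bar R}.
Local Notation V := (L2space mu).
Implicit Types f g h : V.

Lemma L2dotDr f g h : L2dot f (g + h) = L2dot f g + L2dot f h.
Proof. by apply: dotDr; [exact: L2dotC|exact: L2dotDl]. Qed.

Lemma L2dotZr a f g : L2dot f (a *: g) = a * L2dot f g.
Proof. by apply: dotZr; [exact: L2dotC|exact: L2dotZl]. Qed.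

Lemma L2dotBl f g h : L2dot (f - g) h = L2dot f h - L2dot g h.
Proof. by apply: dotBl; [exact: L2dotDl|exact: L2dotZl]. Qed.

Lemma L2dot0l g : L2dot (0 : V) g = 0.
Proof. by apply: dot0l; exact: L2dotZl. Qed.

Lemma L2dot_sumr I (r : seq I) f (F : I -> V) :
  L2dot f (\sum_(i <- r) F i) = \sum_(i <- r) L2dot f (F i).
Proof.
elim: r => [|i r IH]; first by rewrite !big_nil L2dotC L2dot0l.
by rewrite !big_cons L2dotDr IH.
Qed.

Lemma L2dot_norm f g : `|L2dot f g| <= `|f| * `|g|.
Proof.
by apply: dot_normM; [exact: L2dotC|exact: L2dotDl|exact: L2dotZl|exact: L2dotE].
Qed.

Lemma L2dot_eq0 f : L2dot f f = 0 -> f = 0.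
Proof. by rewrite L2dotE => /eqP; rewrite expf_eq0/= normr_eq0 => /eqP. Qed.

(** The common passage to the limit for weak derivatives, weak Laplacians and Green's formula: both
    sides are continuous in the approximated vectors. *)
Lemma L2dot_limit u v f g : (forall e, 0 < e -> exists u' v' : V,
    [/\ `|u - u'| <= e, `|v - v'| <= e & L2dot u' f = L2dot v' g]) ->
  L2dot u f = L2dot v g.
Proof.
move=> h; apply/eqP; rewrite -subr_eq0 -normr_le0; apply/ler_addgt0Pr => e e0; rewrite add0r.
have C0 : 0 < `|f| + `|g| + 1 by rewrite ltr_wpDl ?addr_ge0.
have [u' [v' [uu' vv' e1]]] := h _ (divr_gt0 e0 C0).
have -> : L2dot u f - L2dot v g = L2dot (u - u') f - L2dot (v - v') g.
  by rewrite !L2dotBl e1; ring.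
apply: (le_trans (ler_normB _ _)).
apply: (@le_trans _ _ (e / (`|f| + `|g| + 1) * (`|f| + `|g|))).
  rewrite mulrDr lerD// (le_trans (L2dot_norm _ _))//; exact: ler_wpM2r.
by rewrite mulrAC ler_pdivrMr// ler_pM2l// lerDl.
Qed.

(* [0] if [F] is not square integrable. *)
Definition L2_of (F : T -> R) : V :=
  if pselect (F \in Lfun mu 2%:E) is left FL then mkL2 FL else 0.

Lemma L2_ofE (F : T -> R) : F \in Lfun mu 2%:E -> (L2_of F : T -> R) = F %[ae mu].
Proof. by rewrite /L2_of; case: pselect => // FL _; exact: mkL2E. Qed.

Lemma L2dot_of f (F : T -> R) : F \in Lfun mu 2%:E ->
  L2dot f (L2_of F) = \int[mu]_x (f x * F x).
Proof.
move=> FL; apply: L2dot_classE; last exact: L2_ofE.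
exact: (set_mem (sub_Lfun_mfun FL)).
Qed.

End L2_dot_theory.

Section weak_derivatives.
Variables (R : realType) (N : nat) (Omega : domain R N).
Local Notation mu := (lebesgue_on Omega).
Local Notation V := (L2 Omega).
Local Notation test := (test_function Omega).
Local Notation "[ 'cls' phi ]" := (L2_of mu phi : V) (format "[ 'cls'  phi ]").
Implicit Types (u v w : V) (phi psi : 'rV[R]_N -> R) (s : seq 'I_N).

Lemma dot_cls u phi : test phi -> L2dot u [cls phi] = \int[mu]_x (u x * phi x).
Proof. by move=> /test_Lfun2; exact: L2dot_of. Qed.

Lemma dot_cls2 phi psi : test phi -> test psi ->
  L2dot [cls phi] [cls psi] = \int[mu]_x (phi x * psi x).
Proof.
move=> t1 t2; rewrite dot_cls//; apply: ae_eq_Rintegral.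
- apply: measurable_funM; first exact: measurable_L2fun.
  exact: continuous_rV_measurable (test_continuous t2).
- apply: measurable_funM; apply: continuous_rV_measurable;
  [exact: test_continuous t1|exact: test_continuous t2].
- by apply: filterS (L2_ofE (test_Lfun2 t1)) => x h xT; congr (_ * _); exact: h.
Qed.

Lemma cls_lin (a : R) phi psi : test phi -> test psi ->
  [cls fun x => a * phi x + psi x] = a *: [cls phi] + [cls psi].
Proof.
move=> t1 t2; apply: L2_eqP.
apply: filterS3 (L2_ofE (test_Lfun2 (test_lin a t1 t2)))
  (filterI (addL2E (a *: [cls phi]) [cls psi]) (scaleL2E a [cls phi]))
  (filterI (L2_ofE (test_Lfun2 t1)) (L2_ofE (test_Lfun2 t2))) => x.
by move=> + [+ +] [+ +] xT => -> // -> // -> // -> // ->.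
Qed.

Lemma cls0 : [cls cst 0] = 0.
Proof.
apply: L2_eqP; apply: ae_eq_trans (L2_ofE (test_Lfun2 (test_cst0 _))) _.
by apply: ae_eq_sym; exact: zeroL2E.
Qed.

Lemma test_classesE v : test_classes Omega v <-> exists2 phi, test phi & v = [cls phi].
Proof.
split=> [[phi t e]|[phi t ->]]; exists phi => //; last exact: L2_ofE (test_Lfun2 t).
by apply: L2_eqP; apply: ae_eq_trans e _; apply: ae_eq_sym; exact: L2_ofE (test_Lfun2 t).
Qed.

Lemma cls_parts i phi psi : test phi -> test psi ->
  L2dot [cls partial i phi] [cls psi] = - L2dot [cls phi] [cls partial i psi].
Proof.
move=> t1 t2; rewrite !dot_cls2//; first exact: test_parts.
  exact: test_partial.
exact: test_partial.
Qed.

Lemma test_orth_eq0 u : (forall phi, test phi -> L2dot u [cls phi] = 0) -> u = 0.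
Proof.
by move=> h; apply: L2_test_orth_eq0 => phi t; rewrite -dot_cls// h.
Qed.

Lemma test_orth_eq u v : (forall phi, test phi -> L2dot u [cls phi] = L2dot v [cls phi]) -> u = v.
Proof.
move=> h; apply/eqP; rewrite -subr_eq0; apply/eqP/test_orth_eq0 => phi t.
by rewrite L2dotBl h// subrr.
Qed.

(** Writes the defining integrals as inner products with fixed vectors, which makes linearity and
    limits immediate. *)
Lemma weak_partialsE s u v : weak_partials s u v <->
  forall phi, test phi ->
    L2dot u [cls partials s phi] = (-1) ^+ size s * L2dot v [cls phi].
Proof.
split=> h phi t.
  by rewrite dot_cls ?h ?dot_cls//; exact: test_partials.
by have := h _ t; rewrite !dot_cls//; exact: test_partials.
Qed.

Lemma weak_partials_unique s u v w : weak_partials s u v -> weak_partials s u w -> v = w.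
Proof.
move=> /weak_partialsE h1 /weak_partialsE h2; apply: test_orth_eq => phi t.
have := h1 _ t; rewrite h2// => /eqP.
by rewrite (inj_eq (mulfI _)) ?signr_eq0// => /eqP.
Qed.

(** [dpartials] is a chosen witness; by uniqueness it equals any weak derivative at hand. *)
Lemma dpartialsE s u v : weak_partials s u v -> dpartials s u = v.
Proof.
move=> h; apply: weak_partials_unique (h).
exact: (@xgetPex _ 0 [set v | weak_partials s u v] (ex_intro _ v h)).
Qed.

Lemma dpartialsP k s u : sobolev Omega k u -> (size s <= k)%N -> weak_partials s u (dpartials s u).
Proof. by move=> + sk => /(_ _ sk)[v h]; rewrite (dpartialsE h). Qed.

Lemma weak_partials_lin s (a : R) u v u' v' : weak_partials s u v -> weak_partials s u' v' ->
  weak_partials s (a *: u + u') (a *: v + v').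
Proof.
move=> /weak_partialsE h1 /weak_partialsE h2; apply/weak_partialsE => phi t.
by rewrite !L2dotDl !L2dotZl h1// h2//; ring.
Qed.

(* Each integration by parts moves the outermost derivative of the test function,
   hence the reversal of the indices. *)
Lemma weak_partials_cls s phi : test phi -> weak_partials s [cls phi] [cls partials (rev s) phi].
Proof.
move=> t; apply/weak_partialsE => psi tp; elim: s phi t => [|i s IH] phi t /=.
  by rewrite expr0 mul1r.
have tps := test_partials s tp.
have -> : L2dot [cls phi] [cls partial i (partials s psi)] =
    - L2dot [cls partial i phi] [cls partials s psi].
  by rewrite cls_parts// opprK.
rewrite IH; last exact: test_partial.
by rewrite rev_cons /partials foldr_rcons exprS mulN1r mulNr.
Qed.

Lemma weak_partials_limit s u v : (forall e, 0 < e -> exists u' v',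
    [/\ `|u - u'| <= e, `|v - v'| <= e & weak_partials s u' v']) -> weak_partials s u v.
Proof.
move=> h; apply/weak_partialsE => phi t; rewrite -L2dotZr.
apply: L2dot_limit => e e0; have [u' [v' [uu' vv' /weak_partialsE w]]] := h e e0.
by exists u', v'; split=> //; rewrite w// L2dotZr.
Qed.

Lemma sobolev_cls k phi : test phi -> sobolev Omega k [cls phi].
Proof. by move=> t s _; exists [cls partials (rev s) phi]; exact: weak_partials_cls. Qed.

Lemma dpartials_cls s phi : test phi -> dpartials s [cls phi] = [cls partials (rev s) phi].
Proof. by move=> t; apply: dpartialsE; exact: weak_partials_cls. Qed.

Lemma dpartials_nil u : dpartials [::] u = u.
Proof. by apply: dpartialsE; apply/weak_partialsE => phi t /=; rewrite expr0 mul1r. Qed.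

Lemma sobolev_lin k a u v : sobolev Omega k u -> sobolev Omega k v -> sobolev Omega k (a *: u + v).
Proof.
move=> su sv s sk; exists (a *: dpartials s u + dpartials s v).
by apply: weak_partials_lin; exact: dpartialsP sk.
Qed.

Lemma dpartials_lin k s a u v : sobolev Omega k u -> sobolev Omega k v -> (size s <= k)%N ->
  dpartials s (a *: u + v) = a *: dpartials s u + dpartials s v.
Proof.
by move=> su sv sk; apply: dpartialsE; apply: weak_partials_lin; exact: dpartialsP sk.
Qed.

Lemma dpartialsB k s u v : sobolev Omega k u -> sobolev Omega k v -> (size s <= k)%N ->
  dpartials s (u - v) = dpartials s u - dpartials s v.
Proof.
by move=> su sv sk; rewrite addrC -scaleN1r (dpartials_lin _ sv su)// scaleN1r addrC.
Qed.

Lemma dpartials_le_sobolev_norm k s u : (size s <= k)%N -> `|dpartials s u| <= sobolev_norm k u.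
Proof.
move=> sk; rewrite -(@ler_pXn2r _ 2) ?nnegrE ?sqrtr_ge0// sqr_sqrtr; last first.
  by apply: sumr_ge0 => m _; apply: sumr_ge0 => t _; exact: sqr_ge0.
have sk' : (size s < k.+1)%N by [].
rewrite (bigD1 (Ordinal sk'))//= (bigD1 (in_tuple s))//= -addrA lerDl.
apply: addr_ge0; first by apply: sumr_ge0 => t _; exact: sqr_ge0.
by apply: sumr_ge0 => m _; apply: sumr_ge0 => t _; exact: sqr_ge0.
Qed.

Lemma sobolev_norm_small k (e : R) : 0 < e -> exists2 d : R, 0 < d &
  forall u, (forall s, (size s <= k)%N -> `|dpartials s u| <= d) -> sobolev_norm k u < e.
Proof.
(* [C] counts the index tuples of length at most [k]; the conclusion rests on [C < (C + 1)^2]. *)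
move=> e0; pose C : R := \sum_(m < k.+1) \sum_(s : m.-tuple 'I_N) 1.
have C0 : 0 <= C by apply: sumr_ge0 => m _; apply: sumr_ge0.
have C1 : 0 < C + 1 by rewrite ltr_wpDl.
exists (e / (C + 1)) => [|w h]; first exact: divr_gt0.
rewrite -(ger0_norm (ltW e0)) -sqrtr_sqr ltr_sqrt ?exprn_gt0//.
apply: (@le_lt_trans _ _ (C * (e / (C + 1)) ^+ 2)).
  rewrite mulr_suml; apply: ler_sum => m _; rewrite mulr_suml; apply: ler_sum => s _.
  rewrite mul1r ler_pXn2r ?nnegrE ?divr_ge0 ?(ltW e0) ?(ltW C1)//.
  by apply: h; rewrite size_tuple -ltnS.
rewrite expr_div_n mulrCA gtr_pMr ?exprn_gt0// ltr_pdivrMr ?exprn_gt0// mul1r.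
rewrite expr2; have := C0; nra.
Qed.

(** The Sobolev norm dominates each derivative and involves only finitely many of them. It can thus
    be traded for one test function that approximates all derivatives at once. *)
Lemma sobolev0P k u : sobolev0 Omega k u <-> sobolev Omega k u /\
  forall e, 0 < e -> exists2 phi, test phi & forall s, (size s <= k)%N ->
    `|dpartials s u - [cls partials (rev s) phi]| <= e.
Proof.
split=> -[su h]; split=> // e e0.
  have [v /test_classesE[phi t ->] uv] := h e e0; exists phi => // s sk.
  rewrite -dpartials_cls// -(dpartialsB su (@sobolev_cls k _ t))//.
  exact: le_trans (dpartials_le_sobolev_norm _ sk) (ltW uv).
have [d d0 dP] := @sobolev_norm_small k e e0.
have [phi t hphi] := h d d0; exists [cls phi]; first by apply/test_classesE; exists phi.
apply: dP => s sk; rewrite (dpartialsB su (@sobolev_cls k _ t))// dpartials_cls//.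
exact: hphi.
Qed.

Lemma sobolev0_cls k phi : test phi -> sobolev0 Omega k [cls phi].
Proof.
move=> t; apply/sobolev0P; split; first exact: sobolev_cls.
move=> e e0; exists phi => // s _; rewrite dpartials_cls// subrr normr0; exact: ltW.
Qed.

Lemma subspace_sobolev0 k : subspace_pred (sobolev0 Omega k).
Proof.
split; first by rewrite -cls0; apply: sobolev0_cls; exact: test_cst0.
move=> a u v /sobolev0P[su hu] /sobolev0P[sv hv]; apply/sobolev0P; split.
  exact: sobolev_lin.
move=> e e0; have a1 : 0 < `|a| + 1 by rewrite ltr_wpDl.
have [phi tp hp] := hu (e / 2 / (`|a| + 1)) (divr_gt0 (divr_gt0 e0 (ltr0Sn _ 1)) a1).
have [psi tq hq] := hv (e / 2) (divr_gt0 e0 (ltr0Sn _ 1)).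
exists (fun x => a * phi x + psi x); first exact: test_lin.
move=> s sk; rewrite (dpartials_lin _ su sv)//.
rewrite partials_lin; [|by case: tp|by case: tq].
rewrite cls_lin; [|exact: test_partials|exact: test_partials].
rewrite opprD addrACA -scalerBr (le_trans (ler_normD _ _))// normrZ.
rewrite [leRHS]splitr lerD//; last exact: hq.
apply: (@le_trans _ _ ((`|a| + 1) * (e / 2 / (`|a| + 1)))).
  by apply: ler_pM => //; [rewrite lerDl|exact: hp].
by rewrite mulrC divfK// gt_eqF.
Qed.

End weak_derivatives.

(** * The distributional Laplacian, Green's formula and the Hessian identity *)

Section weak_laplacians.
Variables (R : realType) (N : nat) (Omega : domain R N).
Local Notation mu := (lebesgue_on Omega).
Local Notation V := (L2 Omega).
Local Notation test := (test_function Omega).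
Local Notation "[ 'cls' phi ]" := (L2_of mu phi : V) (format "[ 'cls'  phi ]").
Implicit Types (u v w : V) (phi psi : 'rV[R]_N -> R).

Lemma test_cls_laplacian phi : test phi -> test (classical_laplacian phi) /\
  [cls classical_laplacian phi] = \sum_i [cls partial i (partial i phi)].
Proof.
move=> t; rewrite /classical_laplacian; elim: (index_enum _) => [|i r [tr IH]].
  rewrite big_nil (_ : (fun _ => _) = cst 0); last by apply/funext => x; rewrite big_nil.
  by rewrite cls0; split=> //; exact: test_cst0.
have ti : test (partial i (partial i phi)) by do 2! apply: test_partial.
rewrite big_cons (_ : (fun _ => _) =
    (fun x => 1 * partial i (partial i phi) x + \sum_(j <- r) partial j (partial j phi) x)).
  by split; [exact: test_lin|rewrite cls_lin// scale1r IH].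
by apply/funext => x; rewrite big_cons mul1r.
Qed.

Lemma weak_laplacianE u v : weak_laplacian u v <->
  forall phi, test phi -> L2dot u [cls classical_laplacian phi] = L2dot v [cls phi].
Proof.
split=> h phi t; have [tl _] := test_cls_laplacian t.
  by rewrite !dot_cls// h.
by rewrite -!dot_cls// h.
Qed.

Lemma weak_laplacian_unique u v w : weak_laplacian u v -> weak_laplacian u w -> v = w.
Proof.
move=> /weak_laplacianE h1 /weak_laplacianE h2; apply: test_orth_eq => phi t.
by rewrite -h1// h2.
Qed.

Lemma laplacianE u v : weak_laplacian u v -> laplacian u = v.
Proof.
move=> h; apply: weak_laplacian_unique (h).
exact: (@xgetPex _ 0 [set v | weak_laplacian u v] (ex_intro _ v h)).
Qed.

Lemma laplacianP u : H_laplacian Omega u -> weak_laplacian u (laplacian u).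
Proof. by move=> [v h]; rewrite (laplacianE h). Qed.

Lemma weak_laplacian_lin (a : R) u v u' v' : weak_laplacian u v -> weak_laplacian u' v' ->
  weak_laplacian (a *: u + u') (a *: v + v').
Proof.
move=> /weak_laplacianE h1 /weak_laplacianE h2; apply/weak_laplacianE => phi t.
by rewrite !L2dotDl !L2dotZl h1// h2.
Qed.

Lemma weak_laplacian_limit u v : (forall e, 0 < e -> exists u' v',
    [/\ `|u - u'| <= e, `|v - v'| <= e & weak_laplacian u' v']) -> weak_laplacian u v.
Proof.
move=> h; apply/weak_laplacianE => phi t.
apply: L2dot_limit => e e0; have [u' [v' [uu' vv' /weak_laplacianE w]]] := h e e0.
by exists u', v'; split=> //; rewrite w.
Qed.

Lemma H_laplacian_lin a u v : H_laplacian Omega u -> H_laplacian Omega v ->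
  H_laplacian Omega (a *: u + v).
Proof.
by move=> [u' hu] [v' hv]; exists (a *: u' + v'); exact: weak_laplacian_lin.
Qed.

Lemma laplacian_lin a u v : H_laplacian Omega u -> H_laplacian Omega v ->
  laplacian (a *: u + v) = a *: laplacian u + laplacian v.
Proof.
by move=> hu hv; apply: laplacianE; apply: weak_laplacian_lin; exact: laplacianP.
Qed.

Lemma laplacianB u v : H_laplacian Omega u -> H_laplacian Omega v ->
  laplacian (u - v) = laplacian u - laplacian v.
Proof.
by move=> hu hv; rewrite addrC -scaleN1r laplacian_lin// scaleN1r addrC.
Qed.

Lemma weak_laplacian_sobolev2 u : sobolev Omega 2 u ->
  weak_laplacian u (\sum_i dpartials [:: i; i] u).
Proof.
move=> su; apply/weak_laplacianE => phi t.
have [_ ->] := test_cls_laplacian t.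
rewrite L2dot_sumr [RHS]L2dotC L2dot_sumr; apply: eq_bigr => i _.
have /weak_partialsE -> // := @dpartialsP _ _ _ 2 [:: i; i] u su isT.
by rewrite /= expr2 mulrNN mulr1 mul1r L2dotC.
Qed.

Lemma sobolev2_H_laplacian u : sobolev Omega 2 u -> H_laplacian Omega u.
Proof. by move=> /weak_laplacian_sobolev2; exists (\sum_i dpartials [:: i; i] u). Qed.

Lemma H_laplacian_cls phi : test phi -> H_laplacian Omega [cls phi].
Proof. by move=> t; apply: sobolev2_H_laplacian; exact: sobolev_cls. Qed.

Lemma laplacian_cls phi : test phi -> laplacian [cls phi] = [cls classical_laplacian phi].
Proof.
move=> t; have [_ ->] := test_cls_laplacian t.
rewrite (laplacianE (weak_laplacian_sobolev2 (sobolev_cls (k := 2) t))).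
by apply: eq_bigr => i _; rewrite dpartials_cls.
Qed.

Lemma sobolev0_2_approx u : sobolev0 Omega 2 u -> forall e : R, 0 < e ->
  exists2 phi, test phi & `|u - [cls phi]| <= e /\ `|laplacian u - laplacian [cls phi]| <= e.
Proof.
move=> /sobolev0P[su hu] e e0.
have N1 : (0 : R) < N%:R + 1 by rewrite ltr_wpDl.
(* The Laplacian adds up [N] second derivatives; dividing by [N + 1] also keeps the error of [u]
   itself below [e]. *)
have [phi t hphi] := hu (e / (N%:R + 1)) (divr_gt0 e0 N1).
have le : e / (N%:R + 1) <= e by rewrite ler_pdivrMr// ler_peMr ?(ltW e0)// lerDr.
exists phi => //; split.
  by apply: le_trans le; have := hphi [::] isT; rewrite dpartials_nil.
rewrite laplacian_cls// (test_cls_laplacian t).2 (laplacianE (weak_laplacian_sobolev2 su)).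
rewrite -sumrB (le_trans (ler_norm_sum _ _ _))//.
apply: (@le_trans _ _ (\sum_(i < N) e / (N%:R + 1))).
  by apply: ler_sum => i _; have := hphi [:: i; i] isT.
rewrite sumr_const card_ord -[(_ / _) *+ _]mulr_natl mulrCA ger_pMr// ler_pdivrMr// mul1r.
by rewrite lerDl.
Qed.

(** For a test function in place of [u] this is the definition of the distributional Laplacian of
    [v]; the general case follows by density. *)
Lemma green_sobolev0 u v : sobolev0 Omega 2 u -> H_laplacian Omega v ->
  L2dot (laplacian u) v = L2dot u (laplacian v).
Proof.
move=> su hv; apply: L2dot_limit => e e0.
have [phi t [h1 h2]] := sobolev0_2_approx su e0.
exists (laplacian [cls phi]), [cls phi]; split=> //.
by rewrite laplacian_cls// L2dotC ((weak_laplacianE _ _).1 (laplacianP hv))// L2dotC.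
Qed.

Lemma dot_cls_grad i phi : test phi ->
  `|[cls partial i phi]| ^+ 2 = - L2dot [cls phi] [cls partial i (partial i phi)].
Proof. by move=> t; rewrite -L2dotE (cls_parts i t (test_partial i t)). Qed.

(** Moving [d_i] across and then [d_j] back changes the sign twice; in between,
    [d_i d_i d_j = d_j d_i d_i] by symmetry of mixed derivatives. *)
Lemma dot_cls_hessian i j phi : test phi -> `|[cls partial i (partial j phi)]| ^+ 2 =
  L2dot [cls partial i (partial i phi)] [cls partial j (partial j phi)].
Proof.
move=> t; have ti := test_partial i t; have tj := test_partial j t.
have tii := test_partial i ti; have tij := test_partial i tj.
apply: etrans (esym (L2dotE _)) _.
apply: etrans (cls_parts i tj tij) _.
have -> : partial i (partial i (partial j phi)) = partial j (partial i (partial i phi)).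
  rewrite (partialC i j); last by case: t.
  by rewrite (partialC i j)//; case: ti.
by rewrite [RHS]L2dotC (cls_parts j tj tii).
Qed.

Lemma grad_norm_cls phi : test phi ->
  grad_norm [cls phi] ^+ 2 <= `|[cls phi]| * `|laplacian [cls phi]|.
Proof.
move=> t; rewrite sqr_sqrtr; last by apply: sumr_ge0 => i _; exact: sqr_ge0.
rewrite (_ : \sum_i _ = - L2dot [cls phi] (laplacian [cls phi])).
  by rewrite (le_trans (ler_norm _))// normrN L2dot_norm.
rewrite laplacian_cls// (test_cls_laplacian t).2 L2dot_sumr -sumrN.
by apply: eq_bigr => i _; rewrite dpartials_cls// dot_cls_grad.
Qed.

Lemma ler_term_sum2 (I : finType) (F : I -> I -> R) i j : (forall k l, 0 <= F k l) ->
  F i j <= \sum_k \sum_l F k l.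
Proof.
move=> F0; rewrite (bigD1 i)//= (bigD1 j)//= -addrA lerDl addr_ge0//.
  by apply: sumr_ge0.
by apply: sumr_ge0 => k _; apply: sumr_ge0.
Qed.

Lemma hessian_cls i j phi : test phi ->
  `|[cls partial i (partial j phi)]| <= `|laplacian [cls phi]|.
Proof.
move=> t; rewrite -(@ler_pXn2r _ 2) ?nnegrE//.
have -> : `|laplacian [cls phi]| ^+ 2 = \sum_k \sum_l `|[cls partial k (partial l phi)]| ^+ 2.
  rewrite -L2dotE laplacian_cls// (test_cls_laplacian t).2 L2dot_sumr.
  apply: eq_bigr => k _; rewrite L2dotC L2dot_sumr; apply: eq_bigr => l _.
  by apply: esym; exact: dot_cls_hessian.
apply: (ler_term_sum2 (F := fun k l => `|[cls partial k (partial l phi)]| ^+ 2)) => k l.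
exact: sqr_ge0.
Qed.

End weak_laplacians.

(** * A priori estimates *)

Section friedrichs.
Variables (R : realType) (N : nat) (Omega : domain R N).
Hypothesis adm : friedrichs_admissible Omega.
Local Notation mu := (lebesgue_on Omega).
Local Notation V := (L2 Omega).
Local Notation test := (test_function Omega).
Local Notation "[ 'cls' phi ]" := (L2_of mu phi : V) (format "[ 'cls'  phi ]").
Local Notation c := (friedrichs_const Omega).
Implicit Types (u v w : V) (phi psi : 'rV[R]_N -> R).

Lemma friedrichs_const_ge0 : 0 <= c.
Proof. by apply: lb_le_inf => // x [/ltW]. Qed.

(** The infimum is itself an admissible factor: divide by the gradient norm, or, if that is zero,
    use any Friedrichs constant to get [u = 0]. *)
Lemma friedrichs_le u : sobolev0 Omega 1 u -> `|u| <= c * grad_norm u.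
Proof.
move=> su; have g0 : 0 <= grad_norm u by exact: sqrtr_ge0.
have [gu|gu] := eqVneq (grad_norm u) 0.
  by have [k [_ /(_ _ su)]] := adm; rewrite gu !mulr0.
have gp : 0 < grad_norm u by rewrite lt_neqAle eq_sym gu.
rewrite -ler_pdivrMr//; apply: lb_le_inf => // k [_ /(_ _ su)].
by rewrite ler_pdivrMr.
Qed.

(** Divide [|grad phi|^2 <= |phi| |Delta phi| <= c |grad phi| |Delta phi|] by the gradient norm. *)
Lemma grad_norm_le_laplacian phi : test phi -> grad_norm [cls phi] <= c * `|laplacian [cls phi]|.
Proof.
move=> t; have g0 : 0 <= grad_norm [cls phi] by exact: sqrtr_ge0.
have [->|gu] := eqVneq (grad_norm [cls phi]) 0.
  by rewrite mulr_ge0// friedrichs_const_ge0.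
have gp : 0 < grad_norm [cls phi] by rewrite lt_neqAle eq_sym gu.
rewrite -(ler_pM2r gp) -expr2 (le_trans (grad_norm_cls t))//.
rewrite mulrAC ler_wpM2r//; exact: friedrichs_le (sobolev0_cls 1 t).
Qed.

Lemma cls_le_laplacian phi : test phi -> `|[cls phi]| <= c ^+ 2 * `|laplacian [cls phi]|.
Proof.
move=> t; rewrite (le_trans (friedrichs_le (sobolev0_cls 1 t)))//.
rewrite expr2 -mulrA ler_wpM2l ?friedrichs_const_ge0//; exact: grad_norm_le_laplacian.
Qed.

Lemma partial_cls_le_laplacian i phi : test phi ->
  `|[cls partial i phi]| <= c * `|laplacian [cls phi]|.
Proof.
move=> t; rewrite (le_trans _ (grad_norm_le_laplacian t))//.
rewrite -(@ler_pXn2r _ 2) ?nnegrE ?sqrtr_ge0// sqr_sqrtr; last first.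
  by apply: sumr_ge0 => j _; exact: sqr_ge0.
rewrite (bigD1 i)//= dpartials_cls//= lerDl.
by apply: sumr_ge0 => j _; exact: sqr_ge0.
Qed.

(** The summands [c ^+ 2], [c] and [1] account for the orders zero, one and two. *)
Lemma partials_cls_le_laplacian s phi : (size s <= 2)%N -> test phi ->
  `|[cls partials s phi]| <= (1 + c + c ^+ 2) * `|laplacian [cls phi]|.
Proof.
move=> s2 t; have c0 := friedrichs_const_ge0; have l0 := normr_ge0 (laplacian [cls phi]).
have := sqr_ge0 c => c20; rewrite !mulrDl mul1r.
case: s s2 => [|i [|j [|//]]] _ /=.
- by rewrite ler_wpDl ?addr_ge0 ?mulr_ge0//; exact: cls_le_laplacian.
- rewrite ler_wpDr ?mulr_ge0// ler_wpDl//; exact: partial_cls_le_laplacian.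
- by rewrite -addrA ler_wpDr ?addr_ge0 ?mulr_ge0//; exact: hessian_cls.
Qed.

Lemma sobolev0_le_laplacian u : sobolev0 Omega 2 u -> `|u| <= c ^+ 2 * `|laplacian u|.
Proof.
move=> su; apply/ler_addgt0Pr => e e0.
have c20 := sqr_ge0 c; have c1 : 0 < 1 + c ^+ 2 by rewrite ltr_wpDr.
(* The errors of [u] and of [c^2 Delta u] then add up to exactly [e]. *)
have [phi t [h1 h2]] := sobolev0_2_approx su (divr_gt0 e0 c1).
have h3 := cls_le_laplacian t.
have h4 : `|u| <= `|u - [cls phi]| + `|[cls phi]|.
  by rewrite -{1}(subrK [cls phi] u); exact: ler_normD.
have h5 : `|laplacian [cls phi]| <= `|laplacian u| + `|laplacian u - laplacian [cls phi]|.
  by rewrite -[X in `|X| <= _](subKr (laplacian u)); exact: ler_normB.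
have h6 : c ^+ 2 * `|laplacian [cls phi]| <= c ^+ 2 * (`|laplacian u| + e / (1 + c ^+ 2)).
  by rewrite ler_wpM2l// (le_trans h5)// lerD2l.
rewrite (le_trans h4)//; apply: (le_trans (lerD h1 (le_trans h3 h6))).
rewrite mulrDr addrCA lerD2l -{1}[e / _]mul1r -mulrDl mulrCA divff ?mulr1//.
by rewrite gt_eqF.
Qed.

Local Notation M := (@laplacian R N Omega @` sobolev0 Omega 2).

Lemma sobolev0_H_laplacian u : sobolev0 Omega 2 u -> H_laplacian Omega u.
Proof. by move=> [su _]; exact: sobolev2_H_laplacian. Qed.

Lemma subspace_laplacian_range : subspace_pred M.
Proof.
have [S0 Slin] := @subspace_sobolev0 R N Omega 2; split.
  exists 0 => //; apply: laplacianE; apply/weak_laplacianE => phi t.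
  by rewrite !L2dot0l.
move=> a _ _ [u su <-] [v sv <-]; exists (a *: u + v); first exact: Slin.
by rewrite laplacian_lin//; exact: sobolev0_H_laplacian.
Qed.

(** Test functions whose Laplacians converge to [g] are Cauchy together with all derivatives up to
    order two. The limits of the derivatives are the weak derivatives of the limit, whose Laplacian
    is [g]. *)
Lemma closed_laplacian_range : closed M.
Proof.
move=> g /closure_normP gM.
pose C := 1 + c + c ^+ 2.
have C0 : 0 <= C by rewrite addr_ge0 ?sqr_ge0// addr_ge0// friedrichs_const_ge0.
have /choice[phi phiP] : forall n : nat, exists phi, test phi /\
    `|g - laplacian [cls phi]| <= n.+1%:R^-1.
  move=> n; have n0 : (0 : R) < n.+1%:R^-1 / 2 by rewrite divr_gt0// invr_gt0.
  have [_ [w sw <-] gw] := gM _ n0; have [p t [_ h]] := sobolev0_2_approx sw n0.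
  exists p; split=> //; rewrite -(subrK (laplacian w) g) -addrA [leRHS]splitr.
  apply: le_trans (ler_normD _ _) _; apply: lerD; last exact: h.
  exact: ltW gw.
have dist s m n : (size s <= 2)%N ->
    `|[cls partials s (phi m)] - [cls partials s (phi n)]| <= C * (m.+1%:R^-1 + n.+1%:R^-1).
  move=> s2; have [tm hm] := phiP m; have [tn hn] := phiP n.
  have tmn := test_lin (-1) tn tm.
  have := partials_cls_le_laplacian s2 tmn.
  rewrite partials_lin; [|by case: tn|by case: tm].
  rewrite !cls_lin//; [|exact: test_partials|exact: test_partials].
  rewrite laplacian_lin; [|exact: H_laplacian_cls|exact: H_laplacian_cls].
  rewrite !scaleN1r ![- _ + _]addrC => h; apply: (le_trans h).
  rewrite ler_wpM2l// (le_trans (ler_distD g _ _))// lerD//.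
  by rewrite distrC.
(* [U s] is the limit of the derivatives along [s], reversed as in [weak_partials_cls]; it is set to
   0 beyond order two. *)
have /choice[U UP] : forall s : seq 'I_N, exists v : V, (size s <= 2)%N ->
    forall e, 0 < e -> exists n, forall m, (n <= m)%N -> `|[cls partials (rev s) (phi m)] - v| <= e.
  move=> s; have [s2|] := leqP (size s) 2; last by move=> _; exists 0.
  have [|v vP] := @L2_complete _ _ _ mu (fun n => [cls partials (rev s) (phi n)]).
    move=> e e0; have C1 : 0 < 2 * (C + 1) by rewrite mulr_gt0// ltr_wpDl.
    have [n nP] := natSinv_le (divr_gt0 e0 C1); exists n => p q np nq.
    rewrite (le_trans (dist _ _ _ _)) ?size_rev//.
    apply: (@le_trans _ _ ((C + 1) * (e / (2 * (C + 1)) + e / (2 * (C + 1))))).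
      by apply: ler_pM => //; [rewrite lerDl|apply: lerD; exact: nP].
    by rewrite le_eqVlt; apply/orP; left; apply/eqP; field; rewrite gt_eqF// ltr_wpDl.
  by exists v.
(* The thresholds in [UP] depend on [s]. This explicit rate does not, so a single [phi n]
   approximates all derivatives, as [sobolev0P] demands. For [m >= n] the Cauchy bound contributes
   [2 C / (n + 1)] and the limit [1 / (n + 1)]. *)
have Udist s n : (size s <= 2)%N ->
    `|U s - [cls partials (rev s) (phi n)]| <= (2 * C + 1) * n.+1%:R^-1.
  move=> s2; have n0 : (0 : R) < n.+1%:R^-1 by rewrite invr_gt0.
  have [k kP] := UP s s2 _ n0; pose m := maxn k n.
  have h1 := kP m (leq_maxl _ _).
  have h2 := dist (rev s) m n; rewrite size_rev in h2; have {}h2 := h2 s2.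
  have h3 : m.+1%:R^-1 <= n.+1%:R^-1 :> R.
    by rewrite lef_pV2 ?posrE// ler_nat ltnS leq_maxr.
  rewrite (le_trans (ler_distD [cls partials (rev s) (phi m)] _ _))//.
  rewrite distrC [leRHS]mulrDl mul1r addrC; apply: lerD => //.
  rewrite (le_trans h2)// -mulrA mulrCA ler_wpM2l// mulrDl !mul1r.
  by rewrite lerD2r.
have small (e : R) : 0 < e -> exists n, (2 * C + 1) * n.+1%:R^-1 <= e /\ n.+1%:R^-1 <= e.
  move=> e0; have C1 : 0 < 2 * C + 1 by rewrite ltr_wpDl// mulr_ge0.
  have [n nP] := natSinv_le (divr_gt0 e0 C1); exists n; have := nP n (leqnn _).
  rewrite ler_pdivlMr// mulrC => h; split=> //; apply: le_trans h.
  by rewrite ler_peMl// lerDr mulr_ge0.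
have wU s : (size s <= 2)%N -> weak_partials s (U [::]) (U s).
  move=> s2; apply: weak_partials_limit => e e0; have [n [h1 h2]] := small e e0.
  exists [cls phi n], [cls partials (rev s) (phi n)]; split.
  - exact: le_trans (Udist [::] n isT) h1.
  - exact: le_trans (Udist s n s2) h1.
  - by apply: weak_partials_cls; have [] := phiP n.
have sU : sobolev0 Omega 2 (U [::]).
  apply/sobolev0P; split; first by move=> s s2; exists (U s); exact: wU.
  move=> e e0; have [n [h1 _]] := small e e0; exists (phi n); first by have [] := phiP n.
  by move=> s s2; rewrite (dpartialsE (wU s s2)) (le_trans (Udist s n s2)).
exists (U [::]) => //; apply: laplacianE; apply: weak_laplacian_limit => e e0.
have [n [h1 h2]] := small e e0; have [tn gn] := phiP n.
exists [cls phi n], (laplacian [cls phi n]); split.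
- exact: le_trans (Udist [::] n isT) h1.
- exact: le_trans gn h2.
- by apply: laplacianP; exact: H_laplacian_cls.
Qed.

End friedrichs.

(** * The Neumann bi-Laplacian *)

Section neumann.
Variables (R : realType) (N : nat) (Omega : domain R N).
Hypothesis adm : friedrichs_admissible Omega.
Local Notation V := (L2 Omega).
Local Notation c := (friedrichs_const Omega).
Local Notation K := (harmonic_orth Omega).
Local Notation BK := (reduced_neumann_bilaplacian Omega).
Local Notation M := (@laplacian R N Omega @` sobolev0 Omega 2).
Implicit Types (u v w f : V).

Lemma laplacian_sobolev0_inj v w : sobolev0 Omega 2 v -> sobolev0 Omega 2 w ->
  laplacian v = laplacian w -> v = w.
Proof.
move=> sv sw e; apply/eqP; rewrite -subr_eq0 -normr_le0.
have sB := subspaceB (subspace_sobolev0 Omega 2) sv sw.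
have := sobolev0_le_laplacian adm sB.
rewrite laplacianB; [|exact: sobolev0_H_laplacian|exact: sobolev0_H_laplacian].
by rewrite e subrr normr0 mulr0.
Qed.

(* [u] represents the bounded functional [laplacian phi |-> <w, phi>] on the
   closed range of the Laplacian on [sobolev0 2]. *)
Lemma poisson_solution w : exists2 u, M u & weak_laplacian u w.
Proof.
(* The preimage under the Laplacian, well defined on [M] by injectivity on [sobolev0 2]. *)
pose inv m := xget 0 [set p | sobolev0 Omega 2 p /\ laplacian p = m].
have invP m : M m -> sobolev0 Omega 2 (inv m) /\ laplacian (inv m) = m.
  move=> [p sp pm].
  exact: (@xgetPex _ 0 [set p | sobolev0 Omega 2 p /\ laplacian p = m] (ex_intro _ p (conj sp pm))).
have invK p : sobolev0 Omega 2 p -> inv (laplacian p) = p.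
  move=> sp; have [|s1 e1] := invP (laplacian p); first by exists p.
  exact: laplacian_sobolev0_inj.
have [S0 Slin] := subspace_sobolev0 Omega 2.
have [||u Mu hu] := @riesz R V (@L2dot _ _ _ _) (@L2dotC _ _ _ _) (@L2dotDl _ _ _ _)
    (@L2dotZl _ _ _ _) (@L2dotE _ _ _ _) (@L2_complete _ _ _ _) M
    (fun m => L2dot w (inv m)) (`|w| * c ^+ 2) (subspace_laplacian_range Omega)
    (closed_laplacian_range adm).
- move=> a _ _ [p sp <-] [q sq <-].
  rewrite -laplacian_lin; [|exact: sobolev0_H_laplacian|exact: sobolev0_H_laplacian].
  rewrite (invK _ sp) (invK _ sq) (invK _ (Slin a _ _ sp sq)).
  by rewrite L2dotDr L2dotZr.
- move=> _ [p sp <-]; rewrite (invK _ sp) (le_trans (L2dot_norm _ _))// -mulrA.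
  by rewrite ler_wpM2l//; exact: sobolev0_le_laplacian.
exists u => //; apply/weak_laplacianE => phi t.
have sphi := sobolev0_cls 2 t.
have := hu (laplacian (L2_of _ phi)) (ex_intro2 _ _ _ sphi erefl).
by rewrite (invK _ sphi) => ->; rewrite laplacian_cls//; exact: L2dotC.
Qed.

Lemma laplacian_range_orth u : M u -> K u.
Proof.
move=> [p sp <-] h hh; rewrite green_sobolev0//; last by exists 0.
by rewrite (laplacianE hh) L2dotC L2dot0l.
Qed.

(** The residual [u - r] of the projection onto [M] is orthogonal to Laplacians of test functions,
    hence harmonic. It is then orthogonal both to [u] and to [r], so to itself. *)
Lemma harmonic_orth_range u : K u -> M u.
Proof.
move=> Ku.
have [r Mr rP] := @orth_proj R V (@L2dot _ _ _ _) (@L2dotC _ _ _ _) (@L2dotDl _ _ _ _)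
  (@L2dotZl _ _ _ _) (@L2dotE _ _ _ _) (@L2_complete _ _ _ _) M u
  (subspace_laplacian_range Omega) (closed_laplacian_range adm).
have hh : Defs.harmonic Omega (u - r).
  apply/weak_laplacianE => phi t; rewrite L2dot0l L2dotC -laplacian_cls//.
  by apply: rP; exists (L2_of _ phi) => //; exact: sobolev0_cls.
have : L2dot (u - r) (u - r) = 0.
  by rewrite L2dotBl Ku// rP// subrr.
by move=> /L2dot_eq0/eqP; rewrite subr_eq0 => /eqP ->.
Qed.

(** Green's formula moves the Laplacian from the potential [p] of [u] onto [u]; the a priori bound
    is applied to [p], and one factor [|u|] cancels. *)
Lemma reduced_le_laplacian u : K u -> H_laplacian Omega u -> `|u| <= c ^+ 2 * `|laplacian u|.
Proof.
move=> /harmonic_orth_range[p sp pu] hu.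
have [->|u0] := eqVneq u 0; first by rewrite normr0 mulr_ge0// sqr_ge0.
have nu : 0 < `|u| by rewrite normr_gt0.
rewrite -(ler_pM2r nu) -expr2 -L2dotE -{1}pu green_sobolev0//.
apply: le_trans (ler_norm _) _; apply: le_trans (L2dot_norm _ _) _.
rewrite mulrAC; apply: ler_wpM2r => //.
by rewrite -pu; exact: sobolev0_le_laplacian.
Qed.

Lemma dom_neumannE : op_dom (neumann_bilaplacian Omega) =
  [set u | H_laplacian Omega u /\ sobolev0 Omega 2 (laplacian u)].
Proof.
have S v : sobolev0 Omega 2 v -> sobolev0 Omega 2 (- v).
  exact: subspaceN (subspace_sobolev0 Omega 2).
apply/seteqP; split=> u [hu su]; (split; first exact: hu).
  by have := S (- laplacian u) su; rewrite opprK.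
exact: S su.
Qed.

Lemma laplacianN v : H_laplacian Omega v -> laplacian (- v) = - laplacian v.
Proof.
have h0 : weak_laplacian (0 : V) 0 by apply/weak_laplacianE => phi t; rewrite !L2dot0l.
move=> hv; rewrite -[- v]add0r laplacianB//; last by exists 0.
by rewrite (laplacianE h0) add0r.
Qed.

Lemma neumannE u : op_dom (neumann_bilaplacian Omega) u ->
  neumann_bilaplacian Omega u = laplacian (laplacian u).
Proof.
rewrite dom_neumannE => -[hu su].
by rewrite /neumann_bilaplacian/= laplacianN ?opprK//; exact: sobolev0_H_laplacian.
Qed.

Lemma dom_reducedE : op_dom BK =
  [set u | [/\ H_laplacian Omega u, K u & sobolev0 Omega 2 (laplacian u)]].
Proof.
rewrite -[LHS]/(op_dom (neumann_bilaplacian Omega) `&` K) dom_neumannE.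
by apply/seteqP; split=> u => [[[? ?] ?]|[? ? ?]].
Qed.

Lemma reducedE u : op_dom BK u -> BK u = laplacian (laplacian u).
Proof. by move=> [hu _]; rewrite -[LHS]/(neumann_bilaplacian Omega u) neumannE. Qed.

Lemma neumann_range u : op_dom (neumann_bilaplacian Omega) u -> K (neumann_bilaplacian Omega u).
Proof.
move=> hu; rewrite neumannE//; move: hu; rewrite dom_neumannE => -[_ su].
by apply: laplacian_range_orth; exists (laplacian u).
Qed.

Lemma reduced_surj f : K f -> exists2 u, op_dom BK u & BK u = f.
Proof.
move=> /harmonic_orth_range[w sw wf]; have [u Mu uw] := poisson_solution w.
have du : op_dom BK u.
  rewrite dom_reducedE; split; first by exists w.
    exact: laplacian_range_orth.
  by rewrite (laplacianE uw).
by exists u => //; rewrite (reducedE du) (laplacianE uw).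
Qed.

Lemma reduced_green u v : op_dom BK u -> H_laplacian Omega v ->
  L2dot (BK u) v = L2dot (laplacian u) (laplacian v).
Proof.
move=> du hv; rewrite (reducedE du); move: du; rewrite dom_reducedE => -[_ _ su].
exact: green_sobolev0.
Qed.

Lemma reduced_bounds u : op_dom BK u ->
  `|u| <= c ^+ 2 * `|laplacian u| /\
  c ^+ 2 * `|laplacian u| <= c ^+ 4 * `|laplacian (laplacian u)|.
Proof.
rewrite dom_reducedE => -[hu ku su]; split; first exact: reduced_le_laplacian.
rewrite (_ : 4 = 2 + 2)%N// exprD -mulrA ler_wpM2l ?sqr_ge0//.
exact: sobolev0_le_laplacian.
Qed.

Lemma subspace_dom_reduced : subspace_pred (op_dom BK).
Proof.
have [S0 Slin] := subspace_sobolev0 Omega 2.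
have h0 : weak_laplacian (0 : V) 0 by apply/weak_laplacianE => phi t; rewrite !L2dot0l.
rewrite dom_reducedE; split.
  split; [by exists 0|by move=> h _; rewrite L2dot0l|by rewrite (laplacianE h0)].
move=> a u v [hu ku su] [hv kv sv]; split; first exact: H_laplacian_lin.
  by move=> h hh; rewrite L2dotDl L2dotZl ku// kv// mulr0 addr0.
by rewrite (laplacian_lin a hu hv); exact: Slin a _ _ su sv.
Qed.

Lemma reduced_inj u v : op_dom BK u -> op_dom BK v -> BK u = BK v -> u = v.
Proof.
move=> du dv e; have dB := subspaceB subspace_dom_reduced du dv.
move: e; rewrite (reducedE du) (reducedE dv).
move: du dv dB; rewrite dom_reducedE => -[hu ku su] [hv kv sv] [hB kB sB].
move=> /(laplacian_sobolev0_inj su sv) e.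
apply/eqP; rewrite -subr_eq0 -normr_le0.
by have := reduced_le_laplacian kB hB; rewrite (laplacianB hu hv) e subrr normr0 mulr0.
Qed.

Lemma reduced_sym u v : op_dom BK u -> op_dom BK v -> L2dot (BK u) v = L2dot u (BK v).
Proof.
move=> du dv.
have hu : H_laplacian Omega u by move: du; rewrite dom_reducedE => -[].
have hv : H_laplacian Omega v by move: dv; rewrite dom_reducedE => -[].
apply: etrans (reduced_green du hv) _; apply: etrans (L2dotC _ _) _.
by apply: etrans (esym (reduced_green dv hu)) _; exact: L2dotC.
Qed.

Lemma reduced_dom_sub : op_dom BK `<=` K.
Proof. by rewrite dom_reducedE => u []. Qed.

Lemma reduced_range : op_range BK = K.
Proof.
apply/seteqP; split=> [_ [u [du _] <-]|f /reduced_surj[u du <-]]; last by exists u.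
exact: neumann_range du.
Qed.

Lemma neumann_rangeE : op_range (neumann_bilaplacian Omega) = K.
Proof.
apply/seteqP; split=> [_ [u du <-]|f /reduced_surj[u [du _] <-]]; last by exists u.
exact: neumann_range.
Qed.

Lemma closed_harmonic_orth : closed K.
Proof.
exact: (@closed_orth R V (@L2dot _ _ _ _) (@L2dotC _ _ _ _) (@L2dotDl _ _ _ _)
  (@L2dotZl _ _ _ _) (@L2dotE _ _ _ _) (Defs.harmonic Omega)).
Qed.

Lemma subspace_harmonic_orth : subspace_pred K.
Proof.
exact: (@subspace_orth R V (@L2dot _ _ _ _)
  (@L2dotDl _ _ _ _) (@L2dotZl _ _ _ _) (Defs.harmonic Omega)).
Qed.

(** If [v = BK w] is orthogonal to the domain and [w = BK x], then [|w|^2 = <BK x, w> = <x, BK w> =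
    <x, v> = 0]. *)
Lemma reduced_dense : K `<=` closure (op_dom BK).
Proof.
apply: (@dense_of_orth0 R V (@L2dot _ _ _ _) (@L2dotC _ _ _ _) (@L2dotDl _ _ _ _)
  (@L2dotZl _ _ _ _) (@L2dotE _ _ _ _) (@L2_complete _ _ _ _) K).
- exact: subspace_harmonic_orth.
- exact: closed_harmonic_orth.
- exact: subspace_dom_reduced.
- exact: reduced_dom_sub.
move=> v /reduced_surj[w dw <-] h.
have [x dx xw] := reduced_surj (reduced_dom_sub dw).
have : L2dot w w = 0 by rewrite -{1}xw (reduced_sym dx dw) h.
move=> /L2dot_eq0 w0.
have [d0 _] := subspace_dom_reduced.
have h0 : weak_laplacian (0 : V) 0 by apply/weak_laplacianE => phi t; rewrite !L2dot0l.
by rewrite w0 (reducedE d0) !(laplacianE h0).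
Qed.

Lemma reduced_selfadjoint : selfadjoint (@L2dot _ _ _ _) K BK.
Proof.
split; [exact: reduced_dom_sub|by rewrite reduced_range|exact: reduced_dense|].
move=> v w; split=> [[Kv Kw h]|[dv <-]]; last first.
  split; [exact: reduced_dom_sub|exact: (neumann_range dv.1)|].
  by move=> u du; exact: reduced_sym.
(* For an adjoint pair [(v, w)] the candidate is the solution [z] of [BK z = w]. Testing with [u]
   such that [BK u = v - z] gives [|v - z|^2 = <u, w> - <u, BK z> = 0]. *)
have [z dz zw] := reduced_surj Kw.
suff -> : v = z by [].
apply/eqP; rewrite -subr_eq0; apply/eqP/L2dot_eq0.
have Kvz : K (v - z) by apply: subspaceB subspace_harmonic_orth Kv _; exact: reduced_dom_sub.
have [u du uvz] := reduced_surj Kvz.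
by rewrite -{1}uvz L2dotC L2dotBl L2dotC (h _ du) (L2dotC z) (reduced_sym du dz) zw subrr.
Qed.

Lemma reduced_positive : positive_op (@L2dot _ _ _ _) BK.
Proof.
move=> u du u0; have [b _] := reduced_bounds du.
have hu : H_laplacian Omega u by move: du; rewrite dom_reducedE => -[].
rewrite (reduced_green du hu) L2dotE exprn_gt0// normr_gt0.
apply: contraNneq u0 => e.
by move: b; rewrite e normr0 mulr0 normr_le0.
Qed.

Lemma op_inverse_reducedP f : K f ->
  op_dom BK (op_inverse BK f) /\ BK (op_inverse BK f) = f.
Proof.
move=> /reduced_surj[u du uf].
exact: (@xgetPex _ 0 [set u | op_dom BK u /\ BK u = f] (ex_intro _ u (conj du uf))).
Qed.

Lemma op_norm_inverse_reduced : (op_norm (op_inverse BK) <= (c ^+ 4)%:E)%E.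
Proof.
apply: ub_ereal_sup => _ [f [/= rf f1] <-]; rewrite lee_fin.
have Kf : K f by move: rf; rewrite reduced_range.
have [du uf] := op_inverse_reducedP Kf.
have [b1 b2] := reduced_bounds du; apply: le_trans b1 (le_trans b2 _).
by rewrite -(reducedE du) uf ler_piMr// exprn_even_ge0.
Qed.

Lemma reduced_weakP f u : K f -> u = op_inverse BK f <->
  [/\ H_laplacian Omega u, K u & forall phi, H_laplacian Omega phi ->
      L2dot (laplacian u) (laplacian phi) = L2dot f phi].
Proof.
move=> Kf; have [d e] := op_inverse_reducedP Kf.
have weak phi : H_laplacian Omega phi ->
    L2dot (laplacian (op_inverse BK f)) (laplacian phi) = L2dot f phi.
  by move=> hphi; rewrite -[in RHS]e (reduced_green d hphi).
have [hd kd _] : [/\ H_laplacian Omega (op_inverse BK f), K (op_inverse BK f) &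
    sobolev0 Omega 2 (laplacian (op_inverse BK f))] by move: d; rewrite dom_reducedE.
split=> [->|[hu ku wu]]; first by [].
apply/eqP; rewrite -subr_eq0 -normr_le0.
have hB : H_laplacian Omega (u - op_inverse BK f).
  by rewrite addrC -scaleN1r; exact: H_laplacian_lin.
have kB : K (u - op_inverse BK f) by exact: subspaceB subspace_harmonic_orth ku kd.
apply: le_trans (reduced_le_laplacian kB hB) _.
have : L2dot (laplacian (u - op_inverse BK f)) (laplacian (u - op_inverse BK f)) = 0.
  by rewrite {1}(laplacianB hu hd) L2dotBl (wu _ hB) (weak _ hB) subrr.
by move=> /L2dot_eq0 ->; rewrite normr0 mulr0.
Qed.

End neumann.

Theorem mainTheorem1 (R : realType) (N : nat) (N_gt0 : (0 < N)%N)
    (Omega : domain R N) (Omega_adm : friedrichs_admissible Omega) :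
  let c := friedrichs_const Omega in
  let K := harmonic_orth Omega in
  let B := neumann_bilaplacian Omega in
  let BK := reduced_neumann_bilaplacian Omega in
  (* the operators act as Delta^2 on the stated domains *)
  [/\ op_dom B = [set u | H_laplacian Omega u /\ sobolev0 Omega 2 (laplacian u)],
      forall u, op_dom B u -> B u = laplacian (laplacian u),
      op_dom BK =
        [set u | [/\ H_laplacian Omega u, K u & sobolev0 Omega 2 (laplacian u)]] &
      forall u, op_dom BK u -> BK u = B u] /\
  (* (a) *)
  [/\ op_range B = K, op_range BK = K & closed (op_range B)] /\
  (* (b) *)
  [/\ selfadjoint (@L2dot _ _ _ _) K BK,
      positive_op (@L2dot _ _ _ _) BK,
      set_bij (op_dom BK) K BK,
      (op_norm (op_inverse BK) <= (c ^+ 4)%:E)%E &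
      forall phi, op_dom BK phi ->
        `|phi| <= c ^+ 2 * `|laplacian phi| /\
        c ^+ 2 * `|laplacian phi| <= c ^+ 4 * `|laplacian (laplacian phi)|] /\
  (* (c) *)
  (forall f, K f ->
    unique (fun u => [/\ H_laplacian Omega u, K u, sobolev0 Omega 2 (laplacian u) &
                         laplacian (laplacian u) = f]) (op_inverse BK f) /\
    unique (fun u => [/\ H_laplacian Omega u, K u &
                         forall phi, H_laplacian Omega phi ->
                           L2dot (laplacian u) (laplacian phi) = L2dot f phi])
           (op_inverse BK f)).
Proof.
move=> c K B BK; split; [|split; [|split]].
- split; [exact: dom_neumannE|exact: neumannE|exact: dom_reducedE|by []].
- split; [exact: neumann_rangeE|exact: reduced_range|].
  by rewrite neumann_rangeE//; exact: closed_harmonic_orth.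
- split.
  + exact: reduced_selfadjoint.
  + exact: reduced_positive.
  + split.
    * by move=> u du; apply: neumann_range; exact: du.1.
    * by move=> u v /set_mem du /set_mem dv; exact: reduced_inj.
    * by move=> f /(reduced_surj Omega_adm)[u du uf]; exists u.
  + exact: op_norm_inverse_reduced.
  + exact: reduced_bounds.
- move=> f Kf; have [d e] := op_inverse_reducedP Omega_adm Kf; split; split.
  + have := d; rewrite dom_reducedE => -[hu ku su]; split=> //.
    by rewrite -(reducedE d).
  + move=> u [hu ku su uf].
    have du : op_dom BK u by rewrite dom_reducedE.
    by apply: (reduced_inj Omega_adm d du); rewrite e (reducedE du).
  + exact: (reduced_weakP Omega_adm _ Kf).1.
  + by move=> u hu; apply/esym; exact: (reduced_weakP Omega_adm u Kf).2.
Qed.
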